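(* Let $T=\langle x_1,x_2,x_3,x_4,x_5\rangle$ with $x_i\in\mathbb{Z}_{12}$ be a pitch segment for which there exist integers $\lambda_2,\lambda_3,\lambda_4,\lambda_5$ with $$\lambda_2(x_2-x_1)+\lambda_3(x_3-x_1)+\lambda_4(x_4-x_1)+\lambda_5(x_5-x_1)\equiv 1 \pmod{12}.$$ Suppose that $\widetilde G_T$ (the restriction of $\widetilde G_5$ to $T$) fits into an exact sequence $1\rightarrow Ab_T\rightarrow \widetilde G_T\rightarrow \mathbb{D}_{12}\rightarrow 1$, where $Ab_T$ is an abelian group of order $n$. Then there is a tiled surface $\widetilde{\mathscr V}$ of type $\{5,10\}$ containing all tile occurrences $gT$ ($g\in\widetilde G_T$) of $T$ under $\widetilde G_T$, assembled so that two pentagons have a common side if and only if one is a transform of the other by an inversion in $\mathscr G=\{p_{12},p_{23},p_{34},p_{45},p_{15}\}$. The surface $\widetilde{\mathscr V}$ is an $n$-sheeted (non-branched) covering of a surface $\Gamma$ of genus $13$ having a tiling by $24$ hyperbolic pentagons. The tiling of $\widetilde{\mathscr V}$ has $24n$ hyperbolic pentagons, and $\mathrm{genus}(\widetilde{\mathscr V})=12n+1$.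
   Context: Arithmetic of pitches is in $\mathbb{Z}_{12}=\mathbb{Z}/12\mathbb{Z}$. For $m\in\mathbb{Z}_{12}$ put $T_m(x)=x+m$ and $I_m(x)=-x+m$, acting componentwise on vectors in $\mathbb{Z}_{12}^5$. The $T/I$ group $\{T_m,I_m: m\in\mathbb{Z}_{12}\}$ is isomorphic to the dihedral group $\mathbb{D}_{12}$ of order $24$. For $i\ne j$ the contextual inversion $p_{ij}:\mathbb{Z}_{12}^5\to\mathbb{Z}_{12}^5$ is $p_{ij}\langle y_1,\dots,y_5\rangle=I_{y_i+y_j}\langle y_1,\dots,y_5\rangle$. The group $\widetilde G_5$ is the group of operators generated by $\mathscr G=\{p_{12},p_{23},p_{34},p_{45},p_{15}\}$. It is a semidirect product of $\mathbb{Z}_2$ (generated by $p_{12}$) and an abelian group isomorphic to $\mathbb{Z}_{12}^4$ consisting of contextual translations, with basis $T^2_1,T^3_1,T^4_1,T^5_1$, where $T^j_i\langle y_1,\dots,y_5\rangle=T_{y_j-y_i}\langle y_1,\dots,y_5\rangle$. Under the displayed congruence condition, the group of permutations of the $24$-element $T/I$-orbit of $T$ induced by $\widetilde G_5$ is isomorphic to $\mathbb{D}_{12}$. The restriction $\widetilde G_T$ of $\widetilde G_5$ to $T$ is a quotient group of $\widetilde G_5$, with surjection $\pi:\widetilde G_5\to\widetilde G_T$, through which the action of $\widetilde G_5$ on the $T/I$-orbit of $T$ factors. In the exact sequence, $\widetilde G_T\to\mathbb{D}_{12}$ is the induced map onto the group of permutations of this orbit. The elements of $\mathscr G$ are also regarded,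 via $\pi$, as elements of $\widetilde G_T$. Tiles: a segment $\langle y_1,\dots,y_5\rangle$ is represented by an oriented pentagon with consecutive vertices labeled $y_1,\dots,y_5$. The tiles are copies $gT$ of such a pentagon, one for each $g\in\widetilde G_T$, and a tile $gT$ is glued to the tile $p_{i,i+1}\,gT$ along the side joining the $i$-th and $(i+1)$-st vertices (indices cyclic mod $5$, $p_{51}=p_{15}$), so that the $i$-th vertex of one is identified with the $(i+1)$-st vertex of the other. Surfaces are closed, connected and orientable. A tiling of type $\{p,q\}$ on a surface is a tiling by (possibly curved) regular $p$-gons, meeting along full sides or at vertices, with exactly $q$ polygons meeting at each vertex. *)

(* Defs.v *)
From HB Require Import structures.
From mathcomp Require Import all_boot all_order all_algebra all_fingroup.
From mathcomp Require Import all_solvable.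
From mathcomp Require Import finmap all_classical all_reals all_analysis.
From mathcomp Require Import ring.
Set Implicit Arguments.
Unset Strict Implicit.
Unset Printing Implicit Defensive.
Import Order.TTheory GRing.Theory Num.Theory.
Import numFieldNormedType.Exports.

(* The five pitches (and the five vertices of a pentagon) are numbered      *)
(* 0, ..., 4, and ordS is the cyclic successor of 'I_5.                     *)

Definition segment := 'rV['Z_12]_5.

Section Segments.
Local Open Scope ring_scope.

Definition transposition (m : 'Z_12) (y : segment) : segment :=
  \row_i (y 0 i + m).

Definition inversion (m : 'Z_12) (y : segment) : segment :=
  \row_i (- y 0 i + m).

Definition TI_orbit (T : segment) : {set segment} :=
  [set transposition m T | m : 'Z_12] :|: [set inversion m T | m : 'Z_12].

Definition contextual (i j : 'I_5) (y : segment) : segment :=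
  inversion (y 0 i + y 0 j) y.

Lemma contextualK (i j : 'I_5) : involutive (contextual i j).
Proof. by move=> y; apply/rowP => k; rewrite !mxE; ring. Qed.

Definition p_ (i j : 'I_5) : {perm segment} :=
  perm (can_inj (contextualK i j)).

End Segments.

Section Groups.
Local Open Scope group_scope.

(* The dihedral group of order 24.                                          *)
Definition D12 : finGroupType := dihedral_gtype 24.

Definition G5 : {group {perm segment}} :=
  <<[set p_ i (ordS i) | i : 'I_5]>>%G.

(* quo : G5 -> GT exhibits GT as a restriction of G5 to T, that is, a       *)
(* quotient of G5 through which the action on the T/I-orbit of T factors.   *)
Definition is_restriction (T : segment) (GT : finGroupType)
    (quo : {morphism G5 >-> GT}) : Prop :=
  quo @* G5 = [set: GT] /\
  forall g y, g \in 'ker quo -> y \in TI_orbit T -> g y = y.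

(* 1 -> A -> B -> cT -> 1 is exact.                                         *)
Definition short_exact (aT bT cT : finGroupType)
    (A : {group aT}) (B : {group bT})
    (f : {morphism A >-> bT}) (h : {morphism B >-> cT}) : Prop :=
  [/\ 'injm f, f @* A = 'ker h & h @* B = [set: cT]].

(* delta : GT -> D_12 is, up to an identification theta of D_12 with the    *)
(* group of permutations of the T/I-orbit of T induced by G5, the map given *)
(* by the action of GT on this orbit.                                       *)
Definition is_induced_action (T : segment) (GT : finGroupType)
    (quo : {morphism G5 >-> GT})
    (delta : {morphism [set: GT] >-> D12})
    (theta : {morphism [set: D12] >-> {perm segment}}) : Prop :=
  isom [set: D12] (restr_perm (TI_orbit T) @* G5) theta /\
  {in G5, forall g, theta (delta (quo g)) = restr_perm (TI_orbit T) g}.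

(* The element p_{i,i+1} g. In {perm segment} the product s * t is          *)
(* "s followed by t", so composing with p on the left is multiplying by p   *)
(* on the right.                                                            *)
Definition invert (GT : finGroupType) (quo : {morphism G5 >-> GT})
    (i : 'I_5) (g : GT) : GT := g * quo (p_ i (ordS i)).

End Groups.

Local Open Scope classical_set_scope.
Local Open Scope ring_scope.

Section HyperbolicPlane.
Variable R : realType.

Definition lorentz (u v : 'cV[R]_3) : R :=
  u 0 0 * v 0 0 + u 1 0 * v 1 0 - u 2 0 * v 2 0.

(* Hyperboloid model.                                                       *)
Definition hplane : set 'cV[R]_3 :=
  [set v | lorentz v v = -1 /\ 0 < v 2 0].

(* Orientation-preserving isometries, the group SO^+(2,1).                  *)
Definition hisometry : set 'M[R]_3 :=
  [set A | [/\ forall u v, lorentz (A *m u) (A *m v) = lorentz u v,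
               \det A = 1 &
               forall v, hplane v -> hplane (A *m v)]].

(* Regular p-gon with all interior angles 2 pi / q, centered at (0,0,1),    *)
(* with its vertices listed counterclockwise; its circumradius r satisfies  *)
(* cosh r = cot (pi / p) cot (pi / q), and it exists for (p-2)(q-2) > 4.    *)
Definition cosh_radius (p q : nat) : R :=
  (tan (pi / p%:R))^-1 * (tan (pi / q%:R))^-1.

Definition hvertex (p q : nat) (k : 'I_p) : 'cV[R]_3 :=
  let c := cosh_radius p q in
  let s := Num.sqrt (c ^+ 2 - 1) in
  let a := 2 * pi * k%:R / p%:R in
  \col_i [:: s * cos a; s * sin a; c]`_i.

(* Geodesic convex hulls in the hyperboloid are central projections of      *)
(* convex hulls, i.e. traces of convex cones.                               *)
Definition hpolygon (p q : nat) : set 'cV[R]_3 :=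
  [set v | hplane v /\ exists a : 'I_p -> R,
     (forall k, 0 <= a k) /\ v = \sum_k a k *: hvertex q k].

Definition hside (p q : nat) (k : 'I_p) : set 'cV[R]_3 :=
  [set v | hplane v /\ exists a b : R,
     [/\ 0 <= a, 0 <= b & v = a *: hvertex q k + b *: hvertex q (ordS k)]].

Definition hside_open (p q : nat) (k : 'I_p) : set 'cV[R]_3 :=
  [set v | hplane v /\ exists a b : R,
     [/\ 0 < a, 0 < b & v = a *: hvertex q k + b *: hvertex q (ordS k)]].

Definition hinterior (p q : nat) : set 'cV[R]_3 :=
  hpolygon p q `\` \bigcup_(k in [set: 'I_p]) hside q k.

End HyperbolicPlane.

Section Surfaces.
Variable R : realType.

(* U is a domain and phi a homeomorphism from U onto an open subset of the  *)
(* hyperbolic plane (the values of phi outside U are irrelevant).           *)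
Definition is_chart (X : topologicalType) (U : set X) (phi : X -> 'cV[R]_3) :=
  [/\ open U, {within U, continuous phi}, {in U &, injective phi},
      phi @` U `<=` @hplane R &
      forall W, open W -> W `<=` U ->
        exists2 V, open V & phi @` W = V `&` @hplane R].

(* An atlas whose transition maps are locally orientation-preserving        *)
(* isometries: it makes X an oriented surface with a hyperbolic metric.     *)
Definition is_hyperbolic_atlas (X : topologicalType)
    (atlas : set (set X * (X -> 'cV[R]_3))) :=
  [/\ forall c, atlas c -> is_chart c.1 c.2,
      forall x, exists2 c, atlas c & c.1 x &
      forall c d x, atlas c -> atlas d -> c.1 x -> d.1 x ->
        exists2 A, hisometry A & \forall y \near x, d.2 y = A *m c.2 y].

(* A closed connected oriented surface with a tiling of type {p,q} by       *)
(* hyperbolic polygons indexed by I: the tile t is the image of the regular *)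
(* polygon under ts_tile t, a local orientation-preserving isometry which   *)
(* is injective on the interior and on each open side; vertices and sides   *)
(* of one tile may be identified with each other, so the q polygons         *)
(* meeting at a vertex are counted by their corners.                        *)
Record tiled_surface (p q : nat) (I : finType) := TiledSurface {
  ts_space :> topologicalType;
  ts_atlas : set (set ts_space * (ts_space -> 'cV[R]_3));
  ts_tile : I -> 'cV[R]_3 -> ts_space;
  ts_compact : compact [set: ts_space];
  ts_hausdorff : hausdorff_space ts_space;
  ts_connected : connected [set: ts_space];
  ts_hyperbolic : is_hyperbolic_atlas ts_atlas;
  ts_tile_continuous : forall t,
    {within hpolygon p q, continuous (ts_tile t)};
  ts_tile_isometry : forall t z c,
    hpolygon p q z -> ts_atlas c -> c.1 (ts_tile t z) ->
    exists2 A, hisometry A &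
      \forall w \near z, hpolygon p q w -> c.2 (ts_tile t w) = A *m w;
  ts_cover : forall x, exists t, (ts_tile t @` hpolygon p q) x;
  ts_interior : forall t u z w,
    hinterior p q z -> hpolygon p q w -> ts_tile t z = ts_tile u w ->
    t = u /\ z = w;
  ts_side_inj : forall t (k : 'I_p), {in hside_open q k &, injective (ts_tile t)};
  ts_side_meet : forall t u (k : 'I_p) z w,
    hside_open q k z -> hpolygon p q w -> ts_tile t z = ts_tile u w ->
    exists2 l : 'I_p, hside_open q l w &
      ts_tile t @` hside q k = ts_tile u @` hside q l;
  ts_corners : forall t (k : 'I_p),
    #|finset (fun c : I * 'I_p =>
        ts_tile c.1 (hvertex R q c.2) == ts_tile t (hvertex R q k))| = q
}.

Section TiledSurfaceTheory.
Variables (p q : nat) (I : finType) (S : tiled_surface p q I).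

Definition tile_vertex (t : I) (k : 'I_p) : S := ts_tile S t (hvertex R q k).

Definition tile_side (t : I) (k : 'I_p) : set S := ts_tile S t @` hside q k.

Definition have_common_side (t u : I) : Prop :=
  exists k l, tile_side t k = tile_side u l.

Definition vertices : set S :=
  [set tile_vertex c.1 c.2 | c in [set: I * 'I_p]].

Definition edges : set (set S) :=
  [set tile_side c.1 c.2 | c in [set: I * 'I_p]].

(* Distinct indices give distinct tiles (ts_interior), so #|I| is the       *)
(* number of faces.                                                         *)
Definition euler_characteristic : int :=
  #|` fset_set vertices|%fset%:Z - #|` fset_set edges|%fset%:Z + #|I|%:Z.

Definition has_genus (g : nat) : Prop :=
  euler_characteristic = 2 - 2 * g%:Z.

End TiledSurfaceTheory.

(* Unbranched coverings with n sheets.                                      *)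
Definition is_covering (n : nat) (X Y : topologicalType) (f : X -> Y) : Prop :=
  continuous f /\
  forall y, exists (U : set Y) (sheet : 'I_n -> set X),
    [/\ open U /\ U y,
        f @^-1` U = \bigcup_(i in [set: 'I_n]) sheet i,
        forall i j, i != j -> sheet i `&` sheet j = set0 &
        forall i, [/\ open (sheet i), {in sheet i &, injective f},
          f @` sheet i = U &
          forall W, open W -> W `<=` sheet i -> open (f @` W)]].

End Surfaces.

Arguments tile_vertex {R p q I} S t k.
Arguments tile_side {R p q I} S t k.
Arguments have_common_side {R p q I} S t u.
Arguments has_genus {R p q I} S g.

(* The side of gT joining its i-th and (i+1)-st vertices is glued to the    *)
(* corresponding side of p_{i,i+1} gT, interchanging these two vertices.    *)
Definition is_assembled (R : realType) (GT : finGroupType)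
    (quo : {morphism G5 >-> GT}) (V : tiled_surface R 5 10 GT) : Prop :=
  forall (g : GT) (i : 'I_5),
    [/\ tile_side V g i = tile_side V (invert quo i g) i,
        tile_vertex V g i = tile_vertex V (invert quo i g) (ordS i) &
        tile_vertex V g (ordS i) = tile_vertex V (invert quo i g) i].

(* Main.v *)
From HB Require Import structures.
Require Import Defs.
From mathcomp Require Import all_boot all_order all_algebra all_fingroup.
From mathcomp Require Import all_solvable.
From mathcomp Require Import finmap all_classical all_reals all_analysis.
From mathcomp Require Import zify ring lra.
Set Implicit Arguments.
Unset Strict Implicit.
Unset Printing Implicit Defensive.
Import Order.TTheory GRing.Theory Num.Theory.
Import numFieldNormedType.Exports.
Local Open Scope classical_set_scope.
Local Open Scope ring_scope.

(* In the hyperboloid model, the regular pentagon with angles pi / 5 is cut out by *)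
(* five linear forms. In the basis of three consecutive vertices these forms, the  *)
(* rotation of the pentagon and the half turns about the midpoints of its sides    *)
(* all have coefficients in Z[phi], with phi the golden ratio.                     *)
(*                                                                                 *)
(* Let a_0, ..., a_4 be nontrivial involutions generating a finite group H such    *)
(* that each c_k = a_k a_(k+1) ... a_(k+4) (indices mod 5) has order two. Glue the *)
(* k-th side of the tile t to the k-th side of the tile t a_k by the half turn     *)
(* about its midpoint. Going around a corner of the tile t one returns to t after  *)
(* exactly ten steps, by the assumption on c_k, while the angles add up to 2 pi;   *)
(* so the ten tiles unfold isometrically around a vertex, and the quotient is a    *)
(* hyperbolic surface with |H| / 2 vertices, 5 |H| / 2 edges and |H| faces.        *)
(*                                                                                 *)
(* For a_k = p_(k,k+1) the product c_k is the inversion y |-> - y + 2 y_k. By the  *)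
(* congruence condition no inversion fixes T, hence the assumptions hold both in   *)
(* GT and in its image D12, and GT -> D12 induces a covering of the corresponding  *)
(* surfaces with as many sheets as the kernel has elements.                        *)

(** * The golden ratio *)

Section GoldenRatio.
Variable R : realType.

(** The construction is carried out for any finite group [H] with a [gluing], then applied to [GT]
    and to [D12]. Counting corners ten by ten and sides two by two gives 5 |H| / 10 vertices and 5
    |H| / 2 edges, so the Euler characteristic is - |H|; with |H| = 24 n the genus is 12 n + 1.

    The heart of the matter is that a corner closes up after exactly ten tiles. Geometrically, ten
    sectors of angle pi / 5 fill a neighbourhood of a point, overlapping only along their boundaries
    ([sig10], [sector_exists], [sector_unique]). Algebraically, the product of the five inversions
    around a corner is an inversion ([corner_turnE]), hence an involution, and it acts nontrivially
    because no inversion fixes T ([inversion_neq]). The lemmas [dom_step], [dom_uniq] and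
    [dom_glued] match the two counts: the tiles around a corner or a side unfold into the plane
    without conflict. This gives the charts ([surface_chart]) and their isometric transitions
    ([surface_transition]).

    The map from [GT] to [D12] respects the gluing elements, so it sends tiles to tiles; above a
    chart lies one copy of it for each element of the kernel ([glued_surface_covering]), and
    exactness gives the kernel n elements. *)

Definition golden : R := 2 * cos (pi / 5).
Local Notation phi := golden.

Let t := (pi / 5 : R).
Let t_gt0 : 0 < t. Proof. by rewrite divr_gt0 ?pi_gt0. Qed.
Let t_lt : t < pi / 2. Proof. by rewrite /t; have := pi_gt0 R; lra. Qed.

Lemma sin_pi5_gt0 : 0 < sin t.
Proof. by apply: sin_gt0_pihalf; rewrite t_gt0 t_lt. Qed.

Lemma golden_gt0 : 0 < phi.
Proof.
by rewrite mulr_gt0 // cos_gt0_pihalf // t_lt andbT /t; have := pi_gt0 R; lra.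
Qed.

(* cos (3 t) = - cos (2 t) for t = pi / 5 *)
Lemma golden_sq : phi ^+ 2 = phi + 1.
Proof.
have c_gt0 := golden_gt0.
have e : cos (t *+ 2 + t) = - cos (t *+ 2).
  have -> : t *+ 2 + t = pi - t *+ 2 by rewrite /t; field.
  by rewrite cosB cospi sinpi; ring.
rewrite cosD sin_mulr2n cos_mulr2n in e.
have s2 := cos2Dsin2 t.
(* As a cubic in cos t, cos (3 t) + cos (2 t) has the root -1; this is the factor phi + 2. *)
have : (phi + 2) * (phi ^+ 2 - phi - 1) = 0.
  rewrite /golden -/t.
  have -> : (2 * cos t + 2) * ((2 * cos t) ^+ 2 - 2 * cos t - 1) =
    2 * ((cos t ^+ 2 *+ 2 - 1) * cos t - (cos t * sin t) *+ 2 * sin t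
         + (cos t ^+ 2 *+ 2 - 1))
    + 4 * cos t * (cos t ^+ 2 + sin t ^+ 2 - 1) by ring.
  by rewrite e s2; ring.
move/eqP; rewrite mulf_eq0 => /orP[/eqP h|/eqP h]; first by exfalso; lra.
by apply/eqP; rewrite -subr_eq0 opprD addrA h.
Qed.

(** The bounds are consecutive Fibonacci quotients. Multiplying each difference by a suitable
    positive factor leaves only phi ^ 2 - phi, hence a positive constant. *)
Lemma golden_bound : 8 / 5 < phi < 13 / 8.
Proof.
have := golden_sq; have := golden_gt0; move: phi => x x0 xx.
have e1 : (x - 8 / 5) * (x + 3 / 5) = 1 / 25.
  have -> : (x - 8 / 5) * (x + 3 / 5) = x ^+ 2 - x - 24 / 25 by field.
  by rewrite xx; field.
have e2 : (13 / 8 - x) * (x + 5 / 8) = 1 / 64.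
  have -> : (13 / 8 - x) * (x + 5 / 8) = x - x ^+ 2 + 65 / 64 by field.
  by rewrite xx; field.
apply/andP; split; rewrite -subr_gt0.
  by rewrite -(pmulr_lgt0 (x - 8 / 5) (_ : 0 < x + 3 / 5)) ?e1; lra.
by rewrite -(pmulr_lgt0 (13 / 8 - x) (_ : 0 < x + 5 / 8)) ?e2; lra.
Qed.

Lemma cos_2pi5 : cos (2 * (pi / 5)) = (phi - 1) / 2.
Proof.
have h : cos t ^+ 2 = (phi + 1) / 4 by rewrite -golden_sq /golden -/t; field.
have -> : 2 * (pi / 5) = t *+ 2 by rewrite /t; ring.
by rewrite cos_mulr2n h; field.
Qed.

Lemma cos_4pi5 : cos (4 * (pi / 5)) = - phi / 2.
Proof.
have -> : 4 * (pi / 5) = (2 * (pi / 5 : R)) *+ 2 by ring.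
rewrite cos_mulr2n cos_2pi5 expr_div_n.
have -> : (phi - 1) ^+ 2 = phi ^+ 2 - 2 * phi + 1 by ring.
by rewrite golden_sq; field.
Qed.

Lemma sin_4pi5 : sin (4 * (pi / 5)) = (phi - 1) * sin (2 * (pi / 5)).
Proof.
have -> : 4 * (pi / 5) = (2 * (pi / 5 : R)) *+ 2 by ring.
by rewrite sin_mulr2n cos_2pi5; field.
Qed.

(** With u = pi / 10, cot (2 u) cot u = cos (2 u) / (2 sin^2 u), and both terms are expressed by cos
    (pi / 5). *)
Lemma cosh_radius_5_10 : cosh_radius R 5 10 = 2 * phi + 1.
Proof.
rewrite /cosh_radius.
have s0 := sin_pi5_gt0; have c0 := golden_gt0; have /andP[b1 b2] := golden_bound.
set u : R := pi / 10.
have tu : pi / 5 = u *+ 2 by rewrite /u; field.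
have su : 0 < sin u.
  by apply: sin_gt0_pihalf; rewrite /u; have := pi_gt0 R; lra.
have cu : 0 < cos u.
  by apply: cos_gt0_pihalf; rewrite /u; have := pi_gt0 R; lra.
rewrite /tan !invfM !invrK.
have cu2 : cos u ^+ 2 = (phi / 2 + 1) / 2.
  by rewrite /golden tu cos_mulr2n; field.
rewrite tu in s0 *.
have -> : cos (u *+ 2) = phi / 2 by rewrite /golden tu; field.
rewrite sin_mulr2n.
have su2 : sin u ^+ 2 = (1 - phi / 2) / 2 by rewrite sin2cos2 cu2; field.
have -> : (cos u * sin u *+ 2)^-1 * (phi / 2) * ((sin u)^-1 * cos u)
  = (phi / 4) / (sin u ^+ 2).
  by field; rewrite !gt_eqF.
rewrite su2.
have hd : 1 - phi / 2 != 0 by rewrite gt_eqF //; lra.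
have hd' : 2 - phi != 0 by rewrite gt_eqF //; lra.
apply/eqP; rewrite -subr_eq0; apply/eqP.
have -> : phi / 4 / ((1 - phi / 2) / 2) - (2 * phi + 1) =
   (2 * (phi ^+ 2 - phi - 1)) / (2 - phi) by field; rewrite hd'.
by rewrite golden_sq; ring.
Qed.

End GoldenRatio.

(** * Coordinates over three consecutive vertices *)

Section ThreeSpace.
Variable F : comPzRingType.

Definition vec3 (x y w : F) : 'cV[F]_3 := \col_i [:: x; y; w]`_i.

Lemma ord3E (i : 'I_3) : [\/ i = 0, i = 1 | i = 2].
Proof.
by case: i => [[|[|[|//]]] ?]; [constructor 1|constructor 2|constructor 3];
  apply: val_inj.
Qed.

Lemma vec3P (z : 'cV[F]_3) : z = vec3 (z 0 0) (z 1 0) (z 2 0).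
Proof.
by apply/matrixP => i j; rewrite (ord1 j) mxE; case: (ord3E i) => ->.
Qed.

Lemma vec3_ext (z w : 'cV[F]_3) :
  z 0 0 = w 0 0 -> z 1 0 = w 1 0 -> z 2 0 = w 2 0 -> z = w.
Proof. by move=> h0 h1 h2; rewrite (vec3P z) h0 h1 h2 -vec3P. Qed.

Lemma sum3 (V : nmodType) (f : 'I_3 -> V) : \sum_i f i = f 0 + f 1 + f 2.
Proof.
rewrite !big_ord_recl big_ord0 addr0 addrA.
by congr (f _ + f _ + f _); apply: val_inj.
Qed.

Lemma det3 (A : 'M[F]_3) :
  \det A = A 0 0 * (A 1 1 * A 2 2 - A 1 2 * A 2 1)
         - A 0 1 * (A 1 0 * A 2 2 - A 1 2 * A 2 0)
         + A 0 2 * (A 1 0 * A 2 1 - A 1 1 * A 2 0).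
Proof.
pose f i j := A (inord i) (inord j).
have e : A = \matrix_(i, j) f i j.
  by apply/matrixP => i j; rewrite mxE /f !inord_val.
have fE (i j : 'I_3) : A i j = f i j by rewrite /f !inord_val.
rewrite !fE [in LHS]e (expand_det_row _ 0) sum3 /cofactor.
rewrite !(expand_det_row _ 0) !big_ord_recl !big_ord0 /cofactor !det_mx11 !mxE.
by rewrite /= /bump /= !(addn0, add0n, addn1, add1n) /=; ring.
Qed.

End ThreeSpace.

Section Coordinates.
Variable R : realType.
Local Notation phi := (golden R).
Local Notation v := (@hvertex R 5 10).
Local Notation V := 'cV[R]_3.

Lemma lorentzC (u w : V) : lorentz u w = lorentz w u.
Proof. by rewrite /lorentz; ring. Qed.
Lemma lorentzDl (u u' w : V) : lorentz (u + u') w = lorentz u w + lorentz u' w.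
Proof. by rewrite /lorentz !mxE; ring. Qed.
Lemma lorentzZl a (u w : V) : lorentz (a *: u) w = a * lorentz u w.
Proof. by rewrite /lorentz !mxE; ring. Qed.
Lemma lorentzDr (u u' w : V) : lorentz w (u + u') = lorentz w u + lorentz w u'.
Proof. by rewrite /lorentz !mxE; ring. Qed.
Lemma lorentzZr a (u w : V) : lorentz w (a *: u) = a * lorentz w u.
Proof. by rewrite /lorentz !mxE; ring. Qed.

(* hyperbolic cosine and sine of the circumradius *)
Definition chr : R := 2 * phi + 1.
Definition shr : R := Num.sqrt (8 * phi + 4).
Local Notation c1 := ((phi - 1) / 2).
Definition sin72 : R := sin (2 * (pi / 5)).
Local Notation s1 := sin72.

Lemma chr_gt0 : 0 < chr.
Proof. by rewrite /chr; have := golden_gt0 R; lra. Qed.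
Lemma shr_gt0 : 0 < shr.
Proof. by rewrite sqrtr_gt0; have := golden_gt0 R; lra. Qed.
Lemma shr_sq : shr ^+ 2 = 8 * phi + 4.
Proof. by rewrite sqr_sqrtr //; have := golden_gt0 R; lra. Qed.
Lemma sin72_gt0 : 0 < s1.
Proof. by rewrite sin_gt0_pihalf //; have := pi_gt0 R; lra. Qed.
Lemma sin72_sq : s1 ^+ 2 = (phi + 2) / 4.
Proof.
rewrite /sin72 sin2cos2 cos_2pi5 expr_div_n.
have -> : (phi - 1) ^+ 2 = phi ^+ 2 - 2 * phi + 1 by ring.
by rewrite golden_sq; field.
Qed.

Lemma hvertexE (k : 'I_5) : v k =
  vec3 (shr * cos (2 * (pi / 5) * k%:R)) (shr * sin (2 * (pi / 5) * k%:R)) chr.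
Proof.
have es : Num.sqrt (chr ^+ 2 - 1) = shr.
  congr Num.sqrt; rewrite /chr.
  have -> : (2 * phi + 1) ^+ 2 - 1 = 4 * phi ^+ 2 + 4 * phi by ring.
  by rewrite golden_sq; ring.
apply/matrixP => i j; rewrite !mxE !cosh_radius_5_10 -/chr es.
by have -> : 2 * pi * k%:R / 5 = 2 * (pi / 5) * k%:R :> R by field.
Qed.

Lemma vE0 : v 0 = vec3 shr 0 chr.
Proof. by rewrite hvertexE /= !mulr0 cos0 sin0 mulr0 mulr1. Qed.
Lemma vE1 : v 1 = vec3 (shr * c1) (shr * s1) chr.
Proof. by rewrite hvertexE /= !mulr1 cos_2pi5. Qed.
Lemma vE2 : v 2 = vec3 (shr * (- phi / 2)) (shr * ((phi - 1) * s1)) chr.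
Proof.
rewrite hvertexE /=.
have -> : 2 * (pi / 5) * 2 = 4 * (pi / 5) :> R by ring.
by rewrite cos_4pi5 sin_4pi5.
Qed.
Lemma vE3 : v 3 = vec3 (shr * (- phi / 2)) (- (shr * ((phi - 1) * s1))) chr.
Proof.
rewrite hvertexE /=.
have -> : 2 * (pi / 5) * 3 = - (4 * (pi / 5)) + pi *+ 2 :> R by field.
by rewrite cosD2pi sinD2pi cosN sinN cos_4pi5 sin_4pi5 mulrN.
Qed.
Lemma vE4 : v 4 = vec3 (shr * c1) (- (shr * s1)) chr.
Proof.
rewrite hvertexE /=.
have -> : 2 * (pi / 5) * 4 = - (2 * (pi / 5)) + pi *+ 2 :> R by field.
by rewrite cosD2pi sinD2pi cosN sinN cos_2pi5 mulrN.
Qed.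

Definition col3 (p q r : R) : V := p *: v 4 + q *: v 0 + r *: v 1.

Lemma col3E p q r : col3 p q r =
  vec3 (shr * (c1 * (p + r) + q)) (shr * s1 * (r - p)) (chr * (p + q + r)).
Proof. by rewrite /col3 vE0 vE1 vE4; apply: vec3_ext; rewrite !mxE /=; field. Qed.

(** Inverse of [col3]: the height gives p + q + r, eliminating q from the first coordinate gives p +
    r, and the second coordinate gives r - p. *)
Definition psum (z : V) : R := (z 2 0 / chr - z 0 0 / shr) / (1 - c1).
Definition pdif (z : V) : R := z 1 0 / (shr * s1).
Definition pc (z : V) : R := (psum z - pdif z) / 2.
Definition rc (z : V) : R := (psum z + pdif z) / 2.
Definition qc (z : V) : R := z 2 0 / chr - psum z.

Let chr_neq0 : chr != 0. Proof. by rewrite gt_eqF ?chr_gt0. Qed.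
Let shr_neq0 : shr != 0. Proof. by rewrite gt_eqF ?shr_gt0. Qed.
Let sin72_neq0 : s1 != 0. Proof. by rewrite gt_eqF ?sin72_gt0. Qed.
Let c1_neq1 : 1 - c1 != 0.
Proof. by rewrite gt_eqF //; have := golden_bound R; lra. Qed.

Lemma psum_col3 p q r : psum (col3 p q r) = p + r.
Proof.
rewrite /psum col3E !mxE /=; rewrite -[RHS](mulfK c1_neq1); congr (_ / _).
by field; rewrite chr_neq0 shr_neq0.
Qed.
Lemma pdif_col3 p q r : pdif (col3 p q r) = r - p.
Proof.
by rewrite /pdif col3E !mxE /= mulrC mulKf // mulf_neq0.
Qed.
Lemma pc_col3 p q r : pc (col3 p q r) = p.
Proof. by rewrite /pc psum_col3 pdif_col3; field. Qed.
Lemma rc_col3 p q r : rc (col3 p q r) = r.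
Proof. by rewrite /rc psum_col3 pdif_col3; field. Qed.
Lemma qc_col3 p q r : qc (col3 p q r) = q.
Proof. by rewrite /qc psum_col3 col3E !mxE /= mulrC mulKf //; ring. Qed.

Lemma col3K z : col3 (pc z) (qc z) (rc z) = z.
Proof.
rewrite col3E.
have -> : pc z + rc z = psum z by rewrite /pc /rc; field.
have -> : rc z - pc z = pdif z by rewrite /pc /rc; field.
have -> : pc z + qc z + rc z = z 2 0 / chr.
  by rewrite /qc /pc /rc; field; rewrite chr_neq0.
have -> : c1 * psum z + qc z = z 0 0 / shr.
  have -> : c1 * psum z + qc z = z 2 0 / chr - (1 - c1) * psum z.
    by rewrite /qc; field; rewrite chr_neq0.
  by rewrite /psum mulrCA divff //; ring.
rewrite [RHS]vec3P /pdif; congr vec3; first by field.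
  by field; rewrite sin72_neq0.
by field.
Qed.

(** Hyperbolic cosines of the side and of the diagonal of the pentagon. *)
Definition gramC : R := 6 * phi + 3.
Definition gramD : R := 14 * phi + 9.

Lemma lorentz_col3 p q r p' q' r' : lorentz (col3 p q r) (col3 p' q' r') =
  - (p * p' + q * q' + r * r') - gramC * (p * q' + q * p' + q * r' + r * q')
  - gramD * (p * r' + r * p').
Proof.
rewrite !col3E /lorentz !mxE /=.
have -> : shr * (c1 * (p + r) + q) * (shr * (c1 * (p' + r') + q')) +
  shr * s1 * (r - p) * (shr * s1 * (r' - p')) -
  chr * (p + q + r) * (chr * (p' + q' + r')) =
  shr ^+ 2 * ((c1 * (p + r) + q) * (c1 * (p' + r') + q')
    + s1 ^+ 2 * (r - p) * (r' - p'))
    - chr ^+ 2 * ((p + q + r) * (p' + q' + r')) by field.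
rewrite shr_sq sin72_sq /chr /gramC /gramD.
apply/eqP; rewrite -subr_eq0; apply/eqP.
set lhs := LHS.
have -> : lhs = (phi ^+ 2 - (phi + 1)) * (- 4 * (q * q')
   + (2 * phi - 5) * (p + r) * (p' + r') + 2 * (r - p) * (r' - p')).
  by rewrite /lhs; field.
by rewrite golden_sq subrr mul0r.
Qed.

End Coordinates.

(** * The rotation of the pentagon and the half turns about its sides *)

Section Isometries.
Variable R : realType.
Local Notation phi := (golden R).
Local Notation v := (@hvertex R 5 10).
Local Notation V := 'cV[R]_3.
Local Notation c1 := ((phi - 1) / 2).
Local Notation s1 := (sin72 R).

Lemma ordS5E (k : 'I_5) : ordS k = k + 1.
Proof. by apply: val_inj; rewrite /= addn1. Qed.

(** Used to carry a computation made at vertex or side 0 around the pentagon by [rho]. *)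
Lemma ord5_ind (P : 'I_5 -> Prop) :
  P 0 -> (forall k, P k -> P (k + 1)) -> forall k, P k.
Proof.
move=> h0 hS; have hn n : P n%:R.
  by elim: n => [//|n /hS]; rewrite -natr1.
by move=> k; rewrite -(natr_Zp (k : 'Z_5)).
Qed.

Lemma ord5E (k : 'I_5) : [\/ k = 0, k = 1, k = 2 | k = 3 \/ k = 4].
Proof.
case: k => [[|[|[|[|[|//]]]]] ?].
- by constructor 1; apply: val_inj.
- by constructor 2; apply: val_inj.
- by constructor 3; apply: val_inj.
- by constructor 4; left; apply: val_inj.
- by constructor 4; right; apply: val_inj.
Qed.

Lemma mulmx_ext m n (A B : 'M[R]_(m, n)) : (forall z : 'cV_n, A *m z = B *m z) -> A = B.
Proof.
move=> h; apply/matrixP => i j.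
by have /matrixP/(_ i 0) := h (delta_mx j 0); rewrite -!colE !mxE.
Qed.

(* The linear form vanishing on the k-th side and positive on the rest of the *)
(* pentagon, written in the coordinates p, q, r over the vertices 4, 0, 1.    *)
Definition nf (k : 'I_5) (z : V) : R :=
  [:: pc z; phi * pc z + qc z; pc z + rc z + phi * qc z; phi * rc z + qc z; rc z]`_k.

Lemma nf_inj (z w : V) : nf 0 z = nf 0 w -> nf 4 z = nf 4 w -> nf 1 z = nf 1 w -> z = w.
Proof.
rewrite /nf /= => h0 h4; rewrite h0 => /addrI h1.
by rewrite -(col3K z) h0 h4 h1 col3K.
Qed.

Lemma nf_linear k : linear_for *%R (nf k).
Proof.
have p a (u w : V) : pc (a *: u + w) = a * pc u + pc w.
  by rewrite /pc /psum /pdif !mxE; ring.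
have r a (u w : V) : rc (a *: u + w) = a * rc u + rc w.
  by rewrite /rc /psum /pdif !mxE; ring.
have q a (u w : V) : qc (a *: u + w) = a * qc u + qc w.
  by rewrite /qc /psum !mxE; ring.
move=> a u w; rewrite /nf !p !q !r.
by case: (ord5E k) => [->|->|->|[->|->]] /=; ring.
Qed.

HB.instance Definition _ k := GRing.isLinear.Build R V R *%R (nf k) (nf_linear k).

Definition rho : 'M[R]_3 :=
  \matrix_(i, j)
  (nth [::] [:: [:: c1; - s1; 0]; [:: s1; c1; 0]; [:: 0; 0; 1]] i)`_j.

Lemma rho_col3 p q r : rho *m col3 p q r = col3 r (p - phi * r) (q + phi * r).
Proof.
rewrite !col3E; apply: vec3_ext; rewrite !mxE sum3 !mxE /=; last by ring.
  apply/eqP; rewrite -subr_eq0; apply/eqP; set lhs := LHS.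
  have -> : lhs = shr R * ((phi ^+ 2 - (phi + 1)) * (p - r) / 4
    + (s1 ^+ 2 - (phi + 2) / 4) * (p - r)) by rewrite /lhs; field.
  by rewrite golden_sq sin72_sq; ring.
by field.
Qed.

Lemma nf_rho k z : nf (k + 1) (rho *m z) = nf k z.
Proof.
rewrite -[z]col3K rho_col3 /nf !(pc_col3, qc_col3, rc_col3).
move: (pc z) (qc z) (rc z) => p q r; have g := golden_sq R.
have e : phi * (phi * r) = phi * r + r by rewrite mulrA -expr2 g; ring.
by case: (ord5E k) => [->|->|->|[->|->]] /=; rewrite ?mulrDr ?mulrN ?e; ring.
Qed.

Lemma nf_rhoX j k z : nf (k + j%:R) (rho ^+ j *m z) = nf k z.
Proof.
elim: j => [|j IH]; first by rewrite addr0 expr0 mul1mx.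
by rewrite -natr1 addrA exprS -mulmxE -mulmxA nf_rho.
Qed.

Lemma rho5 : rho ^+ 5 = 1.
Proof.
apply: mulmx_ext => z; rewrite mul1mx.
by apply: nf_inj; rewrite -[RHS](nf_rhoX 5); congr nf; apply: val_inj.
Qed.

Lemma v2_col3 : v 2 = col3 1 (- phi) phi.
Proof.
rewrite vE2 col3E; apply: vec3_ext; rewrite !mxE /=; last by ring.
  apply/eqP; rewrite -subr_eq0; apply/eqP; set lhs := LHS.
  have -> : lhs = - shr R * (phi ^+ 2 - (phi + 1)) / 2 by rewrite /lhs; field.
  by rewrite golden_sq subrr; ring.
by ring.
Qed.

Lemma v3_col3 : v 3 = col3 phi (- phi) 1.
Proof.
rewrite vE3 col3E; apply: vec3_ext; rewrite !mxE /=; last by ring.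
  apply/eqP; rewrite -subr_eq0; apply/eqP; set lhs := LHS.
  have -> : lhs = - shr R * (phi ^+ 2 - (phi + 1)) / 2 by rewrite /lhs; field.
  by rewrite golden_sq subrr; ring.
by ring.
Qed.

Lemma v0_col3 : v 0 = col3 0 1 0.
Proof. by rewrite /col3 !scale0r scale1r add0r addr0. Qed.
Lemma v1_col3 : v 1 = col3 0 0 1.
Proof. by rewrite /col3 !scale0r scale1r !add0r. Qed.
Lemma v4_col3 : v 4 = col3 1 0 0.
Proof. by rewrite /col3 !scale0r scale1r !addr0. Qed.

Definition v_col3 := (v0_col3, v1_col3, v2_col3, v3_col3, v4_col3).

Lemma nf_v0 k : nf k (v 0) = [:: 0; 1; phi; 1; 0]`_k.
Proof.
rewrite v_col3 /nf !(pc_col3, qc_col3, rc_col3).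
by case: (ord5E k) => [->|->|->|[->|->]] /=; ring.
Qed.

Lemma rho_v k : rho *m v k = v (k + 1).
Proof.
have e : phi * phi = phi + 1 by rewrite -expr2 golden_sq.
case: (ord5E k) => [->|->|->|[->|->]].
- have -> : 0 + 1 = 1 :> 'I_5 by apply: val_inj.
  by rewrite !v_col3 rho_col3; congr col3; ring.
- have -> : 1 + 1 = 2 :> 'I_5 by apply: val_inj.
  by rewrite !v_col3 rho_col3; congr col3; ring.
- have -> : 2 + 1 = 3 :> 'I_5 by apply: val_inj.
  by rewrite !v_col3 rho_col3; congr col3; rewrite ?e; ring.
- have -> : 3 + 1 = 4 :> 'I_5 by apply: val_inj.
  by rewrite !v_col3 rho_col3; congr col3; ring.
- have -> : 4 + 1 = 0 :> 'I_5 by apply: val_inj.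
  by rewrite !v_col3 rho_col3; congr col3; ring.
Qed.

Lemma nf_v k l : nf (k + l) (v k) = [:: 0; 1; phi; 1; 0]`_l.
Proof.
elim/ord5_ind: k => [|k IH]; first by rewrite add0r nf_v0.
by rewrite -rho_v addrAC nf_rho.
Qed.

Definition mid0 : V := v 0 + v 1.

(* The half turn about the line spanned by mid0, on which lorentz is          *)
(* - 2 (1 + gramC).                                                          *)
Definition half0 : 'M[R]_3 :=
  - 1%:M - (1 + gramC R)^-1 *: \matrix_(i, j) (mid0 i 0 * [:: mid0 0 0; mid0 1 0; - mid0 2 0]`_j).

Lemma half0E z : half0 *m z = - z - ((1 + gramC R)^-1 * lorentz mid0 z) *: mid0.
Proof.
rewrite mulmxBl mulNmx mul1mx -scalemxAl -scalerA; congr (_ - _ *: _).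
move: mid0 => m.
by apply/matrixP => i j; rewrite !mxE sum3 !mxE /= (ord1 j) /lorentz; ring.
Qed.

Lemma mid0_col3 : mid0 = col3 0 1 1.
Proof. by rewrite /mid0 /col3 scale0r !scale1r add0r. Qed.

Lemma gramC1_gt0 : 0 < 1 + gramC R.
Proof. by rewrite /gramC; have := golden_gt0 R; lra. Qed.
Let gramC1_neq0 : 1 + gramC R != 0. Proof. by rewrite gt_eqF ?gramC1_gt0. Qed.

Lemma gramCD : gramC R + gramD R = 2 * phi * (1 + gramC R).
Proof.
rewrite /gramC /gramD; have -> : 2 * phi * (1 + (6 * phi + 3))
  = 12 * phi ^+ 2 + 8 * phi by ring.
by rewrite golden_sq; ring.
Qed.

Lemma half0_col3 p q r :
  half0 *m col3 p q r = col3 (- p) (2 * phi * p + r) (2 * phi * p + q).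
Proof.
rewrite half0E {1}mid0_col3 lorentz_col3.
set s := _ * _; have -> : s = - (q + r + 2 * phi * p).
  rewrite /s; apply: (mulfI gramC1_neq0); rewrite mulVKf //.
  transitivity (- (q + r) * (1 + gramC R) - (gramC R + gramD R) * p); first by ring.
  by rewrite gramCD; ring.
by rewrite /col3 /mid0 scalerDr; apply: vec3_ext; rewrite !mxE; ring.
Qed.

Lemma half0_fix : half0 *m mid0 = mid0.
Proof. by rewrite mid0_col3 half0_col3; congr col3; ring. Qed.

Lemma half0K : half0 * half0 = 1.
Proof.
apply: mulmx_ext => z; rewrite mul1mx -mulmxE -mulmxA -[z]col3K !half0_col3.
by congr col3; ring.
Qed.

Lemma nf_half0 z : [/\ nf 0 (half0 *m z) = - nf 0 z,
  nf 1 (half0 *m z) = phi * nf 0 z + nf 4 z,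
  nf 2 (half0 *m z) = (4 * phi + 1) * nf 0 z + nf 3 z,
  nf 3 (half0 *m z) = (4 * phi + 1) * nf 0 z + nf 2 z &
  nf 4 (half0 *m z) = phi * nf 0 z + nf 1 z].
Proof.
rewrite -[z]col3K half0_col3 /nf !(pc_col3, qc_col3, rc_col3) /=.
move: (pc z) (qc z) (rc z) => p q r.
have e : phi * (2 * phi * p) = 2 * phi * p + 2 * p.
  by transitivity (2 * phi ^+ 2 * p); [ring | rewrite golden_sq; ring].
by split; rewrite ?mulrDr ?mulrN ?e; ring.
Qed.

(** The half turn about the midpoint of the k-th side: [rho ^+ (5 - k)] is the inverse of
    [rho ^+ k]. *)
Definition half (k : 'I_5) : 'M[R]_3 := rho ^+ k * half0 * rho ^+ (5 - k).

Lemma half_rho k : half (k + 1) * rho = rho * half k.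
Proof.
rewrite /half -!mulrA -exprSr.
have kl := ltn_ord k.
have [k4|k4] := eqVneq k 4.
  have -> : (k + 1 : 'I_5) = 0%N :> nat by rewrite k4.
  have -> : k = 4%N :> nat by rewrite k4.
  by rewrite expr0 mul1r exprSr rho5 mul1r [in RHS]mulrA -exprS expr1 rho5 mul1r.
have -> : nat_of_ord (k + 1 : 'I_5) = k.+1.
  rewrite /= addn1 modn_small //; move: k4; rewrite -val_eqE /=; move: kl.
  by rewrite ltnS leq_eqVlt => /orP[/eqP->|].
by rewrite subnS prednK ?subn_gt0 // exprS -!mulrA.
Qed.

Lemma half_rhoX k j : half (k + j%:R) * rho ^+ j = rho ^+ j * half k.
Proof.
elim: j => [|j IH]; first by rewrite addr0 expr0 mul1r mulr1.
by rewrite -natr1 addrA exprSr mulrA -[half _ * _ * _]mulrA; rewrite -exprSr exprS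
  mulrA half_rho -mulrA IH mulrA -exprS.
Qed.

Lemma half_0 : half 0 = half0.
Proof. by rewrite /half /= rho5 mul1r mulr1. Qed.

Lemma halfK k : half k * half k = 1.
Proof.
have h : rho ^+ (5 - k) * rho ^+ k = 1 by rewrite -exprD subnK ?rho5 // ltnW.
have h' : rho ^+ k * rho ^+ (5 - k) = 1 by rewrite -exprD subnKC ?rho5 // ltnW.
by rewrite /half !mulrA -(mulrA _ _ (rho ^+ k)) h mulr1 -(mulrA _ half0 half0) half0K mulr1.
Qed.

(** The half turn exchanges the two sides of the line [nf k = 0]. On this line it merely swaps the
    forms k + 1 with k + 4 and k + 2 with k + 3, so it maps the k-th side to itself. *)
Lemma nf_half k z : [/\ nf k (half k *m z) = - nf k z,
  nf (k + 1) (half k *m z) = phi * nf k z + nf (k + 4) z,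
  nf (k + 2) (half k *m z) = (4 * phi + 1) * nf k z + nf (k + 3) z,
  nf (k + 3) (half k *m z) = (4 * phi + 1) * nf k z + nf (k + 2) z &
  nf (k + 4) (half k *m z) = phi * nf k z + nf (k + 1) z].
Proof.
elim/ord5_ind: k z => [z|k IH z]; first by rewrite half_0 !add0r; exact: nf_half0.
have [w ->] : exists w, z = rho *m w.
  by exists (rho ^+ 4 *m z); rewrite mulmxA mulmxE -exprS rho5 mul1mx.
rewrite mulmxA mulmxE half_rho -mulmxE -mulmxA !(addrAC _ 1) !nf_rho.
exact: IH.
Qed.

Lemma half_v k : half k *m v k = v (k + 1).
Proof.
elim/ord5_ind: k => [|k IH].
  by rewrite half_0 add0r !v_col3 half0_col3; congr col3; ring.
by rewrite -!rho_v mulmxA mulmxE half_rho -mulmxE -mulmxA IH !rho_v.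
Qed.

Lemma half_vS k : half k *m v (k + 1) = v k.
Proof. by rewrite -half_v mulmxA mulmxE halfK mul1mx. Qed.

(** By the Cauchy-Schwarz inequality in the first two coordinates, the sign of the Lorentz product
    of two timelike vectors tells whether they lie in the same half of the light cone. *)
Lemma timelike_future (u w : V) : lorentz u u < 0 -> 0 < u 2 0 ->
  lorentz w w < 0 -> (0 < w 2 0) = (lorentz u w < 0).
Proof.
rewrite /lorentz; move: (u 0 0) (u 1 0) (u 2 0) (w 0 0) (w 1 0) (w 2 0).
move=> a b c a' b' c' huu c0 hww.
have cs : (a * a' + b * b') ^+ 2 < (c * c') ^+ 2.
  have := sqr_ge0 (a * b' - b * a'); nra.
apply/idP/idP => h.
  have cc : 0 < c * c' by rewrite mulr_gt0.
  rewrite ltNge; apply/negP => h1.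
  by move: cs; rewrite ltNge ler_pXn2r ?nnegrE //; lra.
rewrite ltNge; apply/negP => h1.
have cc : c * c' <= 0 by rewrite pmulr_rle0.
have : (- (c * c')) ^+ 2 <= (- (a * a' + b * b')) ^+ 2.
  by rewrite ler_pXn2r ?nnegrE //; lra.
by rewrite !sqrrN leNgt cs.
Qed.

(** A fixed vector in the future cone prevents the two sheets of the hyperboloid from being
    exchanged. *)
Lemma hisometry_fix (A : 'M[R]_3) (u : V) :
  (forall z w, lorentz (A *m z) (A *m w) = lorentz z w) -> \det A = 1 ->
  lorentz u u < 0 -> 0 < u 2 0 -> A *m u = u -> hisometry A.
Proof.
move=> hA hd hu u0 fu; split=> // z [z1 z0].
have hz : lorentz z z < 0 by rewrite z1 ltrN10.
split; first by rewrite hA.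
by rewrite (timelike_future hu u0) ?hA // -{1}fu hA -timelike_future.
Qed.

Lemma hisometry1 : hisometry (1 : 'M[R]_3).
Proof. by split=> [u w||u]; rewrite ?mul1mx ?det1. Qed.

Lemma hisometryM (A B : 'M[R]_3) : hisometry A -> hisometry B -> hisometry (A * B).
Proof.
move=> [a1 a2 a3] [b1 b2 b3]; split=> [u w||u hu].
- by rewrite -mulmxE -!mulmxA a1 b1.
- by rewrite -mulmxE det_mulmx a2 b2 mulr1.
- by rewrite -mulmxE -mulmxA; apply: a3; apply: b3.
Qed.

Lemma hisometryX (A : 'M[R]_3) n : hisometry A -> hisometry (A ^+ n).
Proof.
by move=> hA; elim: n => [|n IH]; [exact: hisometry1|rewrite exprS; exact: hisometryM].
Qed.

Lemma hisometry_rho : hisometry rho.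
Proof.
have e0 : (vec3 0 0 1 : V) 0 0 = 0 by rewrite mxE.
have e1 : (vec3 0 0 1 : V) 1 0 = 0 by rewrite mxE.
have e2 : (vec3 0 0 1 : V) 2 0 = 1 by rewrite mxE.
apply: (@hisometry_fix _ (vec3 0 0 1)).
- move=> z w; rewrite /lorentz !mxE !sum3 !mxE /=.
  transitivity ((c1 ^+ 2 + s1 ^+ 2) * (z 0 0 * w 0 0 + z 1 0 * w 1 0) - z 2 0 * w 2 0).
    by ring.
  rewrite sin72_sq expr_div_n sqrrB1 golden_sq.
  by field.
- rewrite det3 !mxE /=.
  transitivity (c1 ^+ 2 + s1 ^+ 2); first by ring.
  rewrite sin72_sq expr_div_n sqrrB1 golden_sq.
  by field.
- by rewrite /lorentz e0 e1 e2; lra.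
- by rewrite e2.
- by apply: vec3_ext; rewrite mxE sum3 e0 e1 e2 !mxE /=; ring.
Qed.

Lemma lorentz_half0 z w : lorentz (half0 *m z) (half0 *m w) = lorentz z w.
Proof.
have m2 : lorentz mid0 mid0 = - 2 * (1 + gramC R).
  by rewrite mid0_col3 lorentz_col3; ring.
have hN (x y : V) : lorentz (- x) y = - lorentz x y by rewrite -scaleN1r lorentzZl mulN1r.
have hN' (x y : V) : lorentz x (- y) = - lorentz x y by rewrite lorentzC hN lorentzC.
rewrite !half0E; move: mid0 m2 => m m2.
rewrite !(lorentzDl, lorentzDr, hN, hN', lorentzZl, lorentzZr).
by rewrite m2 (lorentzC z m); field; exact: gramC1_neq0.
Qed.

Lemma hisometry_half0 : hisometry half0.
Proof.
have m2 : lorentz mid0 mid0 = - 2 * (1 + gramC R).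
  by rewrite mid0_col3 lorentz_col3; ring.
apply: (@hisometry_fix _ mid0).
- exact: lorentz_half0.
- have e i j : half0 i j = - (i == j)%:R - (1 + gramC R)^-1 *
     (mid0 i 0 * [:: mid0 0 0; mid0 1 0; - mid0 2 0]`_j).
    by rewrite !mxE.
  (* Determinant of a rank one perturbation of minus the identity. *)
  transitivity (- 1 - (1 + gramC R)^-1 * lorentz mid0 mid0); last first.
    by rewrite m2; field; exact: gramC1_neq0.
  rewrite det3 !e /= /lorentz; ring.
- by rewrite m2; have := gramC1_gt0; lra.
- by rewrite /mid0 vE0 vE1 !mxE /= addr_gt0 ?chr_gt0.
- exact: half0_fix.
Qed.

Lemma hisometry_half k : hisometry (half k).
Proof.
exact: hisometryM (hisometryM (hisometryX _ hisometry_rho) hisometry_half0)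
  (hisometryX _ hisometry_rho).
Qed.

End Isometries.

(** * The regular pentagon *)

Section Pentagon.
Variable R : realType.
Local Notation phi := (golden R).
Local Notation v := (@hvertex R 5 10).
Local Notation V := 'cV[R]_3.
Local Notation P := (@hpolygon R 5 10).

Lemma rho_surj (z : V) : exists w, z = rho R *m w.
Proof. by exists (rho R ^+ 4 *m z); rewrite mulmxA mulmxE -exprS rho5 mul1mx. Qed.

Lemma ord5B (k l : 'I_5) : exists i, l = k + i.
Proof. by exists (l - k); rewrite addrC subrK. Qed.

Lemma ord5_case (Q : 'I_5 -> Prop) : Q 0 -> Q 1 -> Q 2 -> Q 3 -> Q 4 -> forall k, Q k.
Proof. by move=> ? ? ? ? ? k; case: (ord5E k) => [->|->|->|[->|->]]. Qed.

Lemma ord5_shift (Q : 'I_5 -> Prop) (k : 'I_5) :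
  Q k -> Q (k + 1) -> Q (k + 2) -> Q (k + 3) -> Q (k + 4) -> forall l, Q l.
Proof.
move=> ? ? ? ? ? l; have [i ->] := ord5B k l.
by move: i; apply: ord5_case => //; rewrite addr0.
Qed.

Lemma sum5 (U : nmodType) (f : 'I_5 -> U) : \sum_i f i = f 4 + f 0 + f 1 + f 2 + f 3.
Proof.
rewrite !big_ord_recl big_ord0 addr0.
rewrite (_ : ord0 = 0) // (_ : lift _ _ = 1); last by apply: val_inj.
rewrite (_ : lift _ _ = 2); last by apply: val_inj.
rewrite (_ : lift _ _ = 3); last by apply: val_inj.
rewrite (_ : lift _ _ = 4); last by apply: val_inj.
by rewrite !addrA -(addrC (f 4)) !addrA.
Qed.

Lemma hplane_v k : hplane (v k).
Proof.
elim/ord5_ind: k => [|k IH]; last first.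
  by rewrite -rho_v; have [_ _] := hisometry_rho R; apply.
split; first by rewrite v0_col3 lorentz_col3; ring.
by rewrite vE0 mxE /= chr_gt0.
Qed.

Lemma nf_v_ge0 k l : 0 <= nf k (v l).
Proof.
have [i ->] := ord5B l k; rewrite nf_v; have := golden_gt0 R.
by elim/ord5_case: i => /=; lra.
Qed.

(* Fan triangulation of the pentagon from the vertex 4. *)
Lemma nf_cone (z : V) : (forall k, 0 <= nf k z) ->
  exists a : 'I_5 -> R, (forall k, 0 <= a k) /\ z = \sum_k a k *: v k.
Proof.
move=> h; have := golden_gt0 R; have e : phi * phi = phi + 1 by rewrite -expr2 golden_sq.
move: (h 0) (h 1) (h 2) (h 3) (h 4); rewrite /nf /=.
have zE := col3K z; move: (pc z) (qc z) (rc z) zE => p q r <- h0 h1 h2 h3 h4 phi0.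
pose mk (a0 a1 a2 a3 a4 : R) := fun k : 'I_5 => [:: a0; a1; a2; a3; a4]`_k.
have mk0 a0 a1 a2 a3 a4 : 0 <= a0 -> 0 <= a1 -> 0 <= a2 -> 0 <= a3 -> 0 <= a4 ->
    forall k, 0 <= mk a0 a1 a2 a3 a4 k.
  by move=> ? ? ? ? ?; apply: ord5_case.
have mkE a0 a1 a2 a3 a4 : \sum_k mk a0 a1 a2 a3 a4 k *: v k =
    col3 (a4 + a2 + phi * a3) (a0 - phi * a2 - phi * a3) (a1 + phi * a2 + a3).
  by rewrite sum5 /mk /= !v_col3 /col3; apply: vec3_ext; rewrite !mxE; ring.
have [q0|q0] := leP 0 q.
  exists (mk q r 0 0 p); split; first exact: mk0.
  by rewrite mkE; congr col3; ring.
have phin : phi != 0 by rewrite gt_eqF.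
have pi0 : phi * phi^-1 = 1 by rewrite divff.
have pi0' : phi^-1 = phi - 1.
  by apply: (mulfI phin); rewrite pi0 mulrBr e; ring.
have [rq|rq] := leP 0 (r + q).
  exists (mk 0 (r + q) (- q * (phi - 1)) 0 (p + q * (phi - 1))); split.
    apply: mk0 => //; first by rewrite mulr_ge0 -?pi0' ?invr_ge0; lra.
    have -> : p + q * (phi - 1) = phi^-1 * (phi * p + q).
      by rewrite -pi0'; field.
    by rewrite mulr_ge0 // invr_ge0 ltW.
  have e1 : phi * (- q * (phi - 1)) = - q.
    by transitivity (- q * (phi * phi - phi)); [ring|rewrite e; ring].
  by rewrite mkE e1; congr col3; ring.
have e2 : phi * (phi * r + q) = phi * r + r + phi * q.
  by rewrite mulrDr mulrA e; ring.
have e3 : phi * (- phi * (q + r)) = - (phi + 1) * (q + r).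
  by rewrite -e; ring.
exists (mk 0 0 (phi * r + q) (- phi * (q + r)) (p + r + phi * q)); split.
  by apply: mk0 => //; rewrite mulNr -mulrN mulr_ge0; lra.
by rewrite mkE e2 e3; congr col3; ring.
Qed.

Lemma nf_sum k (a : 'I_5 -> R) : nf k (\sum_i a i *: v i) = \sum_i a i * nf k (v i).
Proof. by rewrite linear_sum; apply: eq_bigr => i _; rewrite linearZ. Qed.

(** Passes from the convex hull of the vertices to an intersection of half planes, so that later
    arguments only compare signs of the five forms. *)
Lemma pentagonP (z : V) : P z <-> hplane z /\ forall k, 0 <= nf k z.
Proof.
split=> -[hz].
  move=> [a [a0 e]]; split=> // k.
  by rewrite e nf_sum sumr_ge0 // => i _; rewrite mulr_ge0 ?nf_v_ge0.
by move=> h; split=> //; exact: nf_cone.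
Qed.

Lemma nf0_side k (z : V) : nf k z = 0 -> z = nf (k + 1) z *: v k + nf (k + 4) z *: v (k + 1).
Proof.
elim/ord5_ind: k z => [z|k IH z].
  rewrite !add0r -[z]col3K /nf !(pc_col3, qc_col3, rc_col3) /= => ->.
  by rewrite mulr0 add0r /col3 scale0r add0r.
have [w ->] := rho_surj z; rewrite !(addrAC _ 1) !nf_rho => /IH {1}->.
by rewrite mulmxDr -!scalemxAr !rho_v.
Qed.

Lemma pentagon_rho (z : V) : P (rho R *m z) <-> P z.
Proof.
have [_ _ hr] := hisometry_rho R; rewrite !pentagonP; split=> -[hz h]; split.
- have [_ _ h4] := hisometryX 4 (hisometry_rho R).
  by have := h4 _ hz; rewrite mulmxA mulmxE -exprSr rho5 mul1mx.
- by move=> k; rewrite -nf_rho.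
- exact: hr.
- move=> k; have -> : k = k + 4 + 1.
    by rewrite -addrA (_ : 4 + 1 = 0) ?addr0 //; apply: val_inj.
  by rewrite nf_rho.
Qed.

Lemma nf_side k (z : V) : nf k z = 0 ->
  nf (k + 2) z = phi * nf (k + 1) z + nf (k + 4) z /\
  nf (k + 3) z = nf (k + 1) z + phi * nf (k + 4) z.
Proof.
move=> /nf0_side e.
have h l : nf l z = nf (k + 1) z * nf l (v k) + nf (k + 4) z * nf l (v (k + 1)).
  by rewrite {1}e linearD !linearZ.
have -> : nf (k + 3) z = nf (k + 1) z + phi * nf (k + 4) z.
  rewrite h nf_v.
  have -> : k + 3 = k + 1 + 2 by rewrite -addrA; congr (_ + _); apply: val_inj.
  by rewrite nf_v /=; ring.
split=> //; rewrite h nf_v.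
have -> : k + 2 = k + 1 + 1 by rewrite -addrA; congr (_ + _); apply: val_inj.
by rewrite nf_v /=; ring.
Qed.

Lemma sideP k (z : V) : @hside R 5 10 k z <-> P z /\ nf k z = 0.
Proof.
rewrite pentagonP; split=> [[hz [a [b [a0 b0 e]]]]|[[hz h] h0]]; last first.
  by split=> //; exists (nf (k + 1) z), (nf (k + 4) z); split=> //;
    rewrite ordS5E; exact: nf0_side.
rewrite ordS5E in e; split; first split=> // l.
  by rewrite e linearD !linearZ /= addr_ge0 // mulr_ge0 ?nf_v_ge0.
rewrite e linearD !linearZ /= -[X in nf X (v k)]addr0 nf_v /=.
have -> : nf k (v (k + 1)) = nf (k + 1 + 4) (v (k + 1)).
  by congr nf; rewrite -addrA -[LHS]addr0; congr (_ + _); apply: val_inj.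
by rewrite nf_v /=; ring.
Qed.

Lemma side_openP k (z : V) : @hside_open R 5 10 k z <->
  [/\ hplane z, nf k z = 0, 0 < nf (k + 1) z & 0 < nf (k + 4) z].
Proof.
split=> [[hz [a [b [a0 b0 e]]]]|[hz h0 h1 h4]]; last first.
  by split=> //; exists (nf (k + 1) z), (nf (k + 4) z); split=> //;
    rewrite ordS5E; exact: nf0_side.
have [_ h0] : P z /\ nf k z = 0.
  by apply/sideP; split=> //; exists a, b; split=> //; apply: ltW.
rewrite ordS5E in e.
have k5 : k + 1 + 4 = k by rewrite -addrA -[RHS]addr0; congr (_ + _); apply: val_inj.
have k14 : k + 4 = k + 1 + 3 by rewrite -addrA; congr (_ + _); apply: val_inj.
split=> //; rewrite e linearD !linearZ /= ?nf_v /=.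
  by rewrite -[X in nf X (v (k + 1))]addr0 nf_v /= mulr0 addr0 mulr1.
by rewrite k14 !nf_v /=; lra.
Qed.

Lemma side_open_pos k (z : V) : @hside_open R 5 10 k z -> forall l, l != k -> 0 < nf l z.
Proof.
move=> /side_openP[hz h0 h1 h4]; have [h2 h3] := nf_side h0; have g := golden_gt0 R.
apply: (ord5_shift (k := k)) => //; first by rewrite eqxx.
  by rewrite h2 addr_gt0 // mulr_gt0.
by rewrite h3 addr_gt0 // mulr_gt0.
Qed.

Lemma side_openW k (z : V) : @hside_open R 5 10 k z -> P z.
Proof.
move=> h; have /side_openP[hz h0 _ _] := h; apply/pentagonP; split=> // l.
by have [->|lk] := eqVneq l k; [rewrite h0|apply/ltW/(side_open_pos h)].
Qed.

Lemma interiorP (z : V) : @hinterior R 5 10 z <-> hplane z /\ forall k, 0 < nf k z.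
Proof.
split=> [[Pz ns]|[hz h]].
  have /pentagonP[hz h] := Pz; split=> // k; rewrite lt_neqAle h andbT eq_sym.
  by apply/eqP => h0; apply: ns; exists k => //; apply/sideP.
split; first by apply/pentagonP; split=> // k; exact: ltW.
by move=> [k _ /sideP[_ h0]]; have := h k; rewrite h0 ltxx.
Qed.

Lemma v_scale_eq k (z : V) (a : R) : hplane z -> 0 <= a -> z = a *: v k -> z = v k.
Proof.
move=> [hz _] a0 e; have [hv _] := hplane_v k; suff a1 : a = 1 by rewrite e a1 scale1r.
move: hz; rewrite e lorentzZl lorentzZr hv mulrN1 mulrN => /eqP; rewrite eqr_opp.
by rewrite -expr2 sqrp_eq1 // => /eqP.
Qed.

Lemma side_cases k (z : V) : P z -> nf k z = 0 ->
  [\/ @hside_open R 5 10 k z, z = v k | z = v (k + 1)].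
Proof.
move=> Pz h0; have /pentagonP[hz h] := Pz; have e := nf0_side h0.
have [h1|h1] := eqVneq (nf (k + 1) z) 0.
  by constructor 3; apply: (v_scale_eq hz (h (k + 4))); rewrite {1}e h1 scale0r add0r.
have [h4|h4] := eqVneq (nf (k + 4) z) 0.
  by constructor 2; apply: (v_scale_eq hz (h (k + 1))); rewrite {1}e h4 scale0r addr0.
by constructor 1; apply/side_openP; split; rewrite // lt_neqAle eq_sym ?h1 ?h4 h.
Qed.

Lemma half_side k (z : V) : P z -> nf k z = 0 ->
  P (half R k *m z) /\ nf k (half R k *m z) = 0.
Proof.
move=> /pentagonP[hz h] h0; have [_ _ hh] := hisometry_half R k.
have [e0 e1 e2 e3 e4] := nf_half k z; rewrite h0 !mulr0 !add0r in e1 e2 e3 e4.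
rewrite h0 oppr0 in e0; split=> //; apply/pentagonP; split; first exact: hh.
by apply: (ord5_shift (k := k)); rewrite ?e0 ?e1 ?e2 ?e3 ?e4.
Qed.

Lemma half_side_open k (z : V) : @hside_open R 5 10 k z -> @hside_open R 5 10 k (half R k *m z).
Proof.
move=> /side_openP[hz h0 h1 h4]; have [_ _ hh] := hisometry_half R k.
have [e0 e1 e2 e3 e4] := nf_half k z; apply/side_openP.
by rewrite e0 e1 e4 h0 !mulr0 !add0r oppr0; split=> //; exact: hh.
Qed.

Lemma v_pentagon k : P (v k).
Proof. by apply/pentagonP; split; [exact: hplane_v|move=> l; exact: nf_v_ge0]. Qed.

End Pentagon.

(** * Tiles around a corner *)

Section Corners.
Variable R : realType.
Local Notation phi := (golden R).
Local Notation v := (@hvertex R 5 10).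
Local Notation V := 'cV[R]_3.
Local Notation P := (@hpolygon R 5 10).
Local Notation rho := (rho R).
Local Notation half := (half R).

Lemma continuous_at_mx (T : topologicalType) m n (f : T -> 'M[R]_(m, n)) x :
  (forall i j, {for x, continuous (fun y => f y i j)}) -> {for x, continuous f}.
Proof.
move=> h A [Q Q_nbhs QA].
have : \forall y \near x, forall i j, Q i j (f y i j).
  apply: filter_forall => i; apply: filter_forall => j.
  exact: (h i j _ (Q_nbhs i j)).
by apply: filterS => y Qy; apply: QA.
Qed.

Lemma continuous_mx (T : topologicalType) m n (f : T -> 'M[R]_(m, n)) :
  (forall i j, continuous (fun x => f x i j)) -> continuous f.
Proof. by move=> h x; apply: continuous_at_mx => i j; exact: h. Qed.

Lemma continuous_mulmx (A : 'M[R]_3) : continuous (fun z : V => A *m z).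
Proof.
apply: continuous_mx => i j; rewrite (ord1 j).
have -> : (fun z : V => (A *m z) i 0) = fun z => A i 0 * z 0 0 + A i 1 * z 1 0 + A i 2 * z 2 0.
  by apply/funext => z; rewrite mxE sum3.
move=> z; have c k : (fun y : V => A i k * y k 0) @ z --> A i k * z k 0.
  exact: (cvgM (cvg_cst _) (@coord_continuous R 3 1 k 0 z)).
exact: (cvgD (cvgD (c 0) (c 1)) (c 2)).
Qed.

Lemma continuous_linear (f : {linear V -> R | *%R}) : continuous f.
Proof.
have -> : (f : V -> R) = fun z => f (delta_mx 0 0) * z 0 0 + f (delta_mx 1 0) * z 1 0
    + f (delta_mx 2 0) * z 2 0.
  apply/funext => z; rewrite {1}(matrix_sum_delta z) linear_sum sum3.
  by rewrite !big_ord1 !linearZ /= ![_ * z _ _]mulrC.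
move=> z; have c k : (fun y : V => f (delta_mx k 0) * y k 0) @ z --> f (delta_mx k 0) * z k 0.
  exact: (cvgM (cvg_cst _) (@coord_continuous R 3 1 k 0 z)).
exact: (cvgD (cvgD (c 0) (c 1)) (c 2)).
Qed.

Lemma continuous_nf k : continuous (nf k : V -> R).
Proof. exact: continuous_linear. Qed.

Lemma lorentz_linear (u : V) : linear_for *%R (lorentz u).
Proof. by move=> a z w; rewrite lorentzDr lorentzZr. Qed.

HB.instance Definition _ (u : V) := GRing.isLinear.Build R V R *%R (lorentz u) (lorentz_linear u).

Lemma continuous_lorentz (u : V) : continuous (lorentz u).
Proof. exact: continuous_linear. Qed.

(* The isometry reached from a tile after crossing j sides in a row around its *)
(* k-th vertex.                                                                *)
Fixpoint wmx (k : 'I_5) (j : nat) : 'M[R]_3 :=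
  if j is i.+1 then wmx k i * half (k + i%:R) else 1.

(** Rotation about the k-th vertex by the interior angle pi / 5: [rho] moves this vertex to the next
    one and the half turn brings it back. *)
Definition sig (k : 'I_5) : 'M[R]_3 := half k * rho.

(** Up to renumbering the vertices of the last tile, crossing different sides in a row is iterating
    a single rotation. *)
Lemma wmx_rho k j : wmx k j * rho ^+ j = sig k ^+ j.
Proof.
elim: j => [|j IH]; first by rewrite mulr1.
rewrite /= [in LHS]exprSr -mulrA [half _ * _]mulrA half_rhoX -(mulrA _ _ rho).
by rewrite mulrA mulrA IH exprSr -mulrA.
Qed.

Lemma hisometry_wmx k j : hisometry (wmx k j).
Proof.
by elim: j => [|j IH]; [exact: hisometry1|apply: hisometryM => //; exact: hisometry_half].
Qed.

Lemma addr4_1 (k : 'I_5) : k + 4 + 1 = k.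
Proof. by rewrite -addrA -[RHS]addr0; congr (_ + _); apply: val_inj. Qed.

Lemma nf_sig k (z : V) : nf k (sig k *m z) = - nf (k + 4) z /\
  nf (k + 4) (sig k *m z) = nf k z + phi * nf (k + 4) z.
Proof.
rewrite /sig -mulmxE -mulmxA; have [-> _ _ _ ->] := nf_half k (rho *m z).
have e : nf k (rho *m z) = nf (k + 4) z by rewrite -[RHS]nf_rho addr4_1.
by rewrite e nf_rho; split=> //; rewrite addrC.
Qed.

Lemma sig_v k : sig k *m v k = v k.
Proof. by rewrite /sig -mulmxE -mulmxA rho_v half_vS. Qed.

Lemma lorentz_sigX k j (z w : V) : lorentz (sig k ^+ j *m z) (sig k ^+ j *m w) = lorentz z w.
Proof.
have [h _ _] := hisometryX j (hisometryM (hisometry_half R k) (hisometry_rho R)).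
exact: h.
Qed.

Lemma sigX_v k j : sig k ^+ j *m v k = v k.
Proof.
by elim: j => [|j IH]; [rewrite mul1mx|rewrite exprSr -mulmxE -mulmxA sig_v].
Qed.

Lemma lorentz_sigX_v k j (z : V) : lorentz (v k) (sig k ^+ j *m z) = lorentz (v k) z.
Proof. by rewrite -{1}(sigX_v k j) lorentz_sigX. Qed.

Lemma nf_corner0 k (z : V) : nf k z = 0 -> nf (k + 4) z = 0 ->
  z = - lorentz (v k) z *: v k.
Proof.
move=> h0 h4; have e := nf0_side h0; rewrite h4 scale0r addr0 in e.
have [hv _] := hplane_v R k.
by rewrite {2}e lorentzZr hv mulrN1 opprK.
Qed.

(** The forms of the two sides at the vertex vanish together only on the line of [v k], where the
    product with [v k] is a coordinate. *)
Lemma corner_inj k (z w : V) : nf k z = nf k w -> nf (k + 4) z = nf (k + 4) w ->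
  lorentz (v k) z = lorentz (v k) w -> z = w.
Proof.
move=> h0 h4 hv; apply/eqP; rewrite -subr_eq0; apply/eqP.
rewrite (@nf_corner0 k (z - w)).
- have -> : lorentz (v k) (z - w) = lorentz (v k) z - lorentz (v k) w by exact: linearB.
  by rewrite hv subrr oppr0 scale0r.
- by rewrite linearB /= h0 subrr.
- by rewrite linearB /= h4 subrr.
Qed.

(* With a = nf k z and b = nf (k + 4) z, sig turns (a, b) into (- b, a + phi b). *)
Lemma nf_sigX k (z : V) : let a := nf k z in let b := nf (k + 4) z in
  let f j := (nf k (sig k ^+ j *m z), nf (k + 4) (sig k ^+ j *m z)) in
  [/\ f 1 = (- b, a + phi * b), f 2 = (- (a + phi * b), phi * (a + b)),
      f 3 = (- (phi * (a + b)), phi * a + b), f 4 = (- (phi * a + b), a) &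
      f 5 = (- a, - b)].
Proof.
move=> a b f; have e (x : R) : phi * (phi * x) = phi * x + x.
  by rewrite mulrA -expr2 golden_sq mulrDl mul1r.
have fS j : f j.+1 = (- (f j).2, (f j).1 + phi * (f j).2).
  by rewrite /f exprS -mulmxE -mulmxA; have [-> ->] := nf_sig k (sig k ^+ j *m z).
have f0 : f 0 = (a, b) by rewrite /f expr0 mul1mx.
have f1 : f 1 = (- b, a + phi * b) by rewrite fS f0.
have f2 : f 2 = (- (a + phi * b), phi * (a + b)).
  by rewrite fS f1 /= mulrDr e; congr pair; ring.
have f3 : f 3 = (- (phi * (a + b)), phi * a + b).
  by rewrite fS f2 /= !mulrDr !e; congr pair; ring.
have f4 : f 4 = (- (phi * a + b), a).
  by rewrite fS f3 /= !mulrDr !e; congr pair; ring.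
by split=> //; rewrite fS f4 /=; congr pair; ring.
Qed.

Lemma sig5 k (z : V) : nf k (sig k ^+ 5 *m z) = - nf k z /\
  nf (k + 4) (sig k ^+ 5 *m z) = - nf (k + 4) z.
Proof. by have [_ _ _ _ [-> ->]] := nf_sigX k z. Qed.

Lemma sig10 k : sig k ^+ 10 = 1.
Proof.
apply: mulmx_ext => z; rewrite mul1mx.
have [a b] := sig5 k z; have [a' b'] := sig5 k (sig k ^+ 5 *m z).
have e : sig k ^+ 10 *m z = sig k ^+ 5 *m (sig k ^+ 5 *m z) by rewrite mulmxA mulmxE -exprD.
apply: (corner_inj (k := k)); last by rewrite lorentz_sigX_v.
  by rewrite e a' a opprK.
by rewrite e b' b opprK.
Qed.

Lemma rho10 : rho ^+ 10 = 1.
Proof. by rewrite (exprD _ 5 5) rho5 mulr1. Qed.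

(** The unfolding closes up because ten angles pi / 5 make a full turn. *)
Lemma wmx10 k j : wmx k (j + 10) = wmx k j.
Proof.
have e i : wmx k i = sig k ^+ i * rho ^+ (9 * i).
  by rewrite -wmx_rho -mulrA -exprD -mulSn exprM rho10 expr1n mulr1.
by rewrite !e mulnDr !exprD sig10 (mulnC 9 10) (exprM _ 10 9) rho10 expr1n !mulr1.
Qed.

(** Minus the Lorentz product is the hyperbolic cosine of the distance, so this cuts out a disc in
    the plane. The radius is small enough for the discs about the five vertices to be disjoint
    ([vball_inj]). *)
Definition vball (k : 'I_5) : set V := [set z | - lorentz (v k) z < 9 / 8].

(* For z = p v4 + q v0 + r v1 in the hyperbolic plane and h = - lorentz v0 z,  *)
(* h^2 - 1 is the positive definite quadratic form K1 (p + r)^2 + K2 (p - r)^2 *)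
(* with K1 = C^2 - (1 + D) / 2 and K2 = (D - 1) / 2, so p and r are small.     *)
Lemma vball0_nf (z : V) : hplane z -> vball 0 z ->
  [/\ nf 0 z < 1 / 4, 1 / 4 < nf 1 z, 1 / 4 < nf 2 z, 1 / 4 < nf 3 z & nf 4 z < 1 / 4].
Proof.
move=> hz hb; have [hz1 hz0] := hz; have [hv1 hv0] := hplane_v R 0.
have h0 : lorentz (v 0) z < 0.
  rewrite -timelike_future //; first by rewrite hv1 ltrN10.
  by rewrite hz1 ltrN10.
move: hb h0 hz1; rewrite /vball /= /nf /= v0_col3.
rewrite -{1 2 3 4}[z]col3K !lorentz_col3.
move: (pc z) (qc z) (rc z) => p q r {hz hz0 hv1 hv0}.
have /andP[g1 g2] := golden_bound R.
have hC : 12 < gramC R < 51 / 4 by rewrite /gramC; lra.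
have hK : 1 / 2 * (gramD R - 1) = 7 * phi + 4 by rewrite /gramD; field.
have hK1 : gramC R ^+ 2 - (1 + gramD R) / 2 = 65 * phi + 40.
  rewrite /gramC /gramD; transitivity (36 * phi ^+ 2 + 29 * phi + 4); first by field.
  by rewrite golden_sq; ring.
set C := gramC R in hC hK1 *; set D := gramD R in hK hK1 *.
pose a := p + r; pose d := p - r; pose h := q + C * a.
rewrite (_ : - (- _ - _ - _) = h); last by rewrite /h /a; ring.
rewrite (_ : - _ - _ - _ = - h) => [|]; last by rewrite /h /a; ring.
move=> h98 h0 hq; rewrite oppr_lt0 in h0.
have key : h ^+ 2 - 1 = (65 * phi + 40) * a ^+ 2 + (7 * phi + 4) * d ^+ 2.
  rewrite -hK1 -hK.
  transitivity (h ^+ 2 + (- (p * p + q * q + r * r) - C * (p * q + q * p + q * r + r * q)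
    - D * (p * r + r * p))); first by rewrite hq.
  by rewrite /h /a /d; field.
have a2 := sqr_ge0 a; have d2 := sqr_ge0 d.
have h2 : h ^+ 2 < 81 / 64.
  have -> : (81 / 64 : R) = (9 / 8) ^+ 2 by field.
  by rewrite ltr_pXn2r ?nnegrE //; lra.
have h1 : 1 <= h.
  rewrite -(@ler_pXn2r _ 2) ?nnegrE ?expr1n //; last by lra.
  suff : 0 <= h ^+ 2 - 1 by lra.
  by rewrite key addr_ge0 // mulr_ge0 //; lra.
(* By [key] and [h2], (65 phi + 40) a^2 and (7 phi + 4) d^2 are below 17 / 64, while phi > 8 / 5. *)
have ha : `|a| < 1 / 23.
  have c0 : (0 : R) <= 1 / 23 by lra.
  rewrite -(@ltr_pXn2r _ 2) ?nnegrE ?c0 // real_normK ?num_real //.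
  have -> : ((1 / 23) ^+ 2 : R) = 1 / 529 by field.
  nra.
have hd : `|d| < 2 / 15.
  have c0 : (0 : R) <= 2 / 15 by lra.
  rewrite -(@ltr_pXn2r _ 2) ?nnegrE ?c0 // real_normK ?num_real //.
  have -> : ((2 / 15) ^+ 2 : R) = 4 / 225 by field.
  nra.
move: ha hd; rewrite !ltr_norml => /andP[a1 a3] /andP[d1 d3].
have ep : p = (a + d) / 2 by rewrite /a /d; field.
have er : r = (a - d) / 2 by rewrite /a /d; field.
have eq : q = h - C * a by rewrite /h; ring.
have ea : p + r = a by [].
move: (a) (d) (h) a1 a3 d1 d3 h1 ep er eq ea {h98 h0 hq key a2 d2 h2} => {}a {}d {}h.
move=> a1 a3 d1 d3 h1 -> -> -> _; move: hC => /andP[C1 C2].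
have /andP[x1 x2] : - (51 / 92) < C * a < 51 / 92 by apply/andP; split; nra.
have /andP[y1 y2] : - (13 / 184) < phi * a < 13 / 184 by apply/andP; split; nra.
have /andP[z1 z2] : - (13 / 60) < phi * d < 13 / 60 by apply/andP; split; nra.
have w : 8 / 5 * (h - C * a) <= phi * (h - C * a) by rewrite ler_wpM2r; lra.
by split; try lra; rewrite mulrA !mulrDr; lra.
Qed.

End Corners.

(** * Ten sectors around a vertex *)

Section CornerCharts.
Variable R : realType.
Local Notation phi := (golden R).
Local Notation v := (@hvertex R 5 10).
Local Notation V := 'cV[R]_3.
Local Notation P := (@hpolygon R 5 10).
Local Notation rho := (rho R).
Local Notation half := (half R).
Local Notation wmx := (wmx R).
Local Notation sig := (sig R).

Lemma vball_rho k (z : V) : vball (k + 1) (rho *m z) <-> vball k z.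
Proof. by rewrite /vball /= -rho_v; have [-> _ _] := hisometry_rho R. Qed.

Lemma hplane_rhoX j (z : V) : hplane (rho ^+ j *m z) <-> hplane z.
Proof.
split=> h; have [_ _ hr] := hisometryX j (hisometry_rho R); last exact: hr.
have [_ _ h9] := hisometryX (9 * j) (hisometry_rho R).
by have := h9 _ h; rewrite mulmxA mulmxE -exprD -mulSnr exprM rho10 expr1n mul1mx.
Qed.

Lemma vball_nf k (z : V) : hplane z -> vball k z ->
  [/\ nf k z < 1 / 4, nf (k + 4) z < 1 / 4 &
      forall l, l != k -> l != k + 4 -> 1 / 4 < nf l z].
Proof.
elim/ord5_ind: k z => [z hz hb|k IH z].
  have [h0 h1 h2 h3 h4] := vball0_nf hz hb; rewrite add0r; split=> //.
  by apply: ord5_case; rewrite ?eqxx.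
have [w ->] := rho_surj z; rewrite vball_rho -[rho]expr1 hplane_rhoX expr1 => hw hb.
have [h0 h1 h2] := IH w hw hb; rewrite addrAC !nf_rho; split=> // l l1 l2.
by rewrite -[l](subrK 1) nf_rho h2 // subr_eq // addrAC.
Qed.

(** The two forms with values below 1 / 4 are those of the sides at the vertex, and they determine
    it. *)
Lemma vball_inj k m (z : V) : hplane z -> vball k z -> vball m z -> k = m.
Proof.
move=> hz /(vball_nf hz)[_ _ h] /(vball_nf hz)[m0 m4 _].
apply/eqP; rewrite eq_sym; apply/negPn/negP => mk.
have [mk4|mk4] := eqVneq m (k + 4); last first.
  by have := h m mk mk4; have := m0; lra.
have e : m + 4 = k + 3 by rewrite mk4 -addrA; congr (_ + _); apply: val_inj.
rewrite e in m4; have := h (k + 3).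
have e3 : k + 3 != k by rewrite -subr_eq0 addrC addrA addNr add0r.
have e4 : k + 3 != k + 4 by rewrite (inj_eq (addrI k)).
by move=> /(_ e3 e4); lra.
Qed.

Lemma vball_sigX k j (z : V) : vball k (sig k ^+ j *m z) <-> vball k z.
Proof. by rewrite /vball /= lorentz_sigX_v. Qed.

Lemma hplane_sigX k j (z : V) : hplane z -> hplane (sig k ^+ j *m z).
Proof.
by have [_ _ h] := hisometryX j (hisometryM (hisometry_half R k) (hisometry_rho R)); apply: h.
Qed.

Lemma pentagon_rhoX j (z : V) : P (rho ^+ j *m z) <-> P z.
Proof.
elim: j => [|j IH]; first by rewrite mul1mx.
by rewrite exprS -mulmxE -mulmxA pentagon_rho.
Qed.

Lemma rhoX_surj j (z : V) : exists w, z = rho ^+ j *m w.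
Proof.
exists (rho ^+ (9 * j) *m z).
by rewrite mulmxA mulmxE -exprD -mulSn exprM rho10 expr1n mul1mx.
Qed.

Lemma corner_pentagon k (y : V) : hplane y -> vball k y ->
  0 <= nf k y -> 0 <= nf (k + 4) y -> P y.
Proof.
move=> hy hb h0 h4; have [_ _ h] := vball_nf hy hb; apply/pentagonP; split=> // l.
have [->//|lk] := eqVneq l k; have [->//|lk4] := eqVneq l (k + 4).
by have := h l lk lk4; lra.
Qed.

(* The ten sectors obtained by turning the corner of the pentagon by multiples of *)
(* pi / 5 cover the plane.                                                        *)
Lemma sector_exists k (x : V) : exists j, [/\ (j < 10)%N,
  0 <= nf k (sig k ^+ j *m x) & 0 <= nf (k + 4) (sig k ^+ j *m x)].
Proof.
have h (z : V) : 0 <= nf k z -> exists j, [/\ (j < 5)%N,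
    0 <= nf k (sig k ^+ j *m z) & 0 <= nf (k + 4) (sig k ^+ j *m z)].
  have [] := nf_sigX k z; set a := nf k z; set b := nf (k + 4) z.
  move=> [a1 b1] [a2 b2] [a3 b3] [a4 b4] _ a0.
  have [b0|b0] := leP 0 b; first by exists 0%N; rewrite mul1mx.
  have [c1|c1] := leP 0 (a + phi * b).
    by exists 1%N; rewrite a1 b1; split=> //; lra.
  have [c2|c2] := leP 0 (phi * (a + b)).
    by exists 2%N; rewrite a2 b2; split=> //; lra.
  have [c3|c3] := leP 0 (phi * a + b).
    by exists 3%N; rewrite a3 b3; split=> //; lra.
  by exists 4%N; rewrite a4 b4; split=> //; lra.
(* [sig k ^+ 5] is the half turn about the vertex, which reduces to a nonnegative first form. *)
have [x0|x0] := leP 0 (nf k x).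
  by have [j [j5 h0 h4]] := h x x0; exists j; split=> //; apply: leq_trans j5 _.
have [s0 s4] := sig5 k x.
have [|j [j5 h0 h4]] := h (sig k ^+ 5 *m x); first by rewrite s0; lra.
rewrite mulmxA mulmxE -exprD in h0 h4.
by exists (j + 5)%N; split=> //; rewrite (ltn_add2r 5 j 5).
Qed.

Lemma corner_cover k (x : V) : hplane x -> vball k x ->
  exists j z, [/\ (j < 10)%N, P z & wmx k j *m z = x].
Proof.
move=> hx hb; have [i [i10 h0 h4]] := sector_exists k x.
pose y := sig k ^+ i *m x.
have Py : P y by apply: corner_pentagon h0 h4; [exact: hplane_sigX|apply/vball_sigX].
(* Treated apart since [10 - i] would be out of range. *)
have [i0|i0] := eqVneq i 0%N.
  by exists 0%N, x; rewrite mul1mx; split=> //; move: Py; rewrite /y i0 mul1mx.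
exists (10 - i)%N, (rho ^+ (10 - i) *m y); split.
- by rewrite ltn_subrL lt0n i0.
- by apply/pentagon_rhoX.
- by rewrite mulmxA mulmxE wmx_rho /y mulmxA mulmxE -exprD subnK ?sig10 ?mul1mx // ltnW.
Qed.

(** Sign conditions on the values in [nf_sigX]: first for the powers 1 to 4 of the rotation, then
    for 5 to 9. *)
Lemma sector_num (p a b : R) : 0 < p -> 0 <= a -> 0 <= b -> [/\
  0 <= - b -> b = 0, 0 <= - (a + p * b) -> a = 0 /\ b = 0,
  0 <= - (p * (a + b)) -> a = 0 /\ b = 0 & 0 <= - (p * a + b) -> a = 0 /\ b = 0] /\ [/\
  0 <= - a -> 0 <= - b -> a = 0 /\ b = 0, 0 <= - a + p * - b -> a = 0 /\ b = 0,
  0 <= p * (- a - b) -> a = 0 /\ b = 0, 0 <= p * - a - b -> a = 0 /\ b = 0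
  & 0 <= - a -> - a = 0].
Proof.
move=> p0 a0 b0.
have e1 (x : R) : 0 <= x -> x <= 0 -> x = 0 by move=> ? ?; apply/eqP; rewrite eq_le; apply/andP.
have e2 (x : R) : 0 <= x -> 0 <= - (p * x) -> x = 0.
  by move=> x0; rewrite oppr_ge0 pmulr_rle0 //; exact: e1.
have pa : 0 <= p * a by rewrite mulr_ge0 // ltW.
have pb : 0 <= p * b by rewrite mulr_ge0 // ltW.
have e3 : 0 <= - (p * (a + b)) -> a = 0 /\ b = 0.
  by move=> /(e2 _ (addr_ge0 a0 b0)) ?; split; lra.
split; split=> h; rewrite ?mulrN in h; try exact: (e3 h); try lra.
all: try by apply: e3; rewrite -mulrN opprD.
all: by split; try lra; apply: e2 => //; lra.
Qed.

(** Closed sectors meet in a common boundary when they are adjacent, that is for d = 1 or 9, and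
    otherwise only on the line of the vertex. *)
Lemma sector_unique k d (y z : V) : (d < 10)%N -> y = sig k ^+ d *m z ->
  0 <= nf k y -> 0 <= nf (k + 4) y -> 0 <= nf k z -> 0 <= nf (k + 4) z ->
  [\/ d = 0%N, d = 1%N /\ nf (k + 4) z = 0, d = 9%N /\ nf (k + 4) y = 0 |
      [/\ nf k z = 0, nf (k + 4) z = 0 & y = z]].
Proof.
move=> d10 e y0 y4 z0 z4; subst y.
have zero : nf k z = 0 -> nf (k + 4) z = 0 ->
    [/\ nf k z = 0, nf (k + 4) z = 0 & sig k ^+ d *m z = z].
  move=> h0 h4; split=> //; have ez := nf_corner0 h0 h4.
  by rewrite {1}ez -scalemxAr sigX_v -ez.
have [] := nf_sigX k z; set a := nf k z in z0 zero *; set b := nf (k + 4) z in z4 zero *.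
move=> [a1 b1] [a2 b2] [a3 b3] [a4 b4] [a5 b5].
have /andP[g1 g2] := golden_bound R.
have e5 j : sig k ^+ j *m (sig k ^+ 5 *m z) = sig k ^+ (j + 5) *m z.
  by rewrite mulmxA mulmxE -exprD.
have [] := nf_sigX k (sig k ^+ 5 *m z); rewrite !e5 a5 b5.
move=> [a6 b6] [a7 b7] [a8 b8] [a9 b9] _.
have phi0 : 0 < phi by exact: golden_gt0.
have ze : a = 0 -> b = 0 -> [\/ d = 0%N, d = 1%N /\ b = 0,
      d = 9%N /\ nf (k + 4) (sig k ^+ d *m z) = 0 |
      [/\ a = 0, b = 0 & sig k ^+ d *m z = z]] by move=> ? ?; constructor 4; apply: zero.
have [[c1 c2 c3 c4] [c5 c6 c7 c8 c9]] := sector_num phi0 z0 z4.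
clearbody a b; clear zero z0 z4 g1 g2 e5.
case: d ze d10 y0 y4 => [|[|[|[|[|[|[|[|[|[|//]]]]]]]]]] ze _ h h'; first by constructor 1.
- by rewrite a1 in h; constructor 2; split=> //; exact: c1.
- by rewrite a2 in h; have [] := c2 h; exact: ze.
- by rewrite a3 in h; have [] := c3 h; exact: ze.
- by rewrite a4 in h; have [] := c4 h; exact: ze.
- by rewrite a5 in h; rewrite b5 in h'; have [] := c5 h h'; exact: ze.
- by rewrite a6 in h; rewrite b6 in h'; have [] := c6 h'; exact: ze.
- by rewrite a7 in h; rewrite b7 in h'; have [] := c7 h'; exact: ze.
- by rewrite a8 in h; rewrite b8 in h'; have [] := c8 h'; exact: ze.
- by rewrite b9 in h'; constructor 3; split=> //; rewrite b9; exact: c9.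
Qed.

End CornerCharts.

(* The five involutions say along which tile each side is glued; the product *)
(* around a corner has order exactly two because ten pentagons meet there.     *)
Record gluing (H : finGroupType) := Gluing {
  glue :> 'I_5 -> H;
  glue_inv : forall i, (glue i * glue i)%g = 1%g;
  glue_neq1 : forall i, glue i != 1%g;
  glue_corner : forall k, (glue k * glue (k + 1)%R * glue (k + 2)%R * glue (k + 3)%R
    * glue (k + 4)%R)%g != 1%g;
  glue_cornerK : forall k, ((glue k * glue (k + 1)%R * glue (k + 2)%R * glue (k + 3)%R
    * glue (k + 4)%R) ^+ 2)%g = 1%g;
  glue_gen : forall G : {group H}, (forall i, glue i \in G) -> forall t, t \in G
}.

(** * Unfolding the tiles around a corner or a side *)

Section Gluing.
Variables (R : realType) (H : finGroupType) (a : gluing H).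
Local Notation v := (@hvertex R 5 10).
Local Notation V := 'cV[R]_3.
Local Notation P := (@hpolygon R 5 10).
Local Notation rho := (rho R).
Local Notation half := (half R).
Local Notation wmx := (wmx R).
Local Notation sig := (sig R).

(* The tile reached from the tile 1 by the side crossings of wmx k j. *)
Fixpoint tl (k : 'I_5) (j : nat) : H :=
  if j is i.+1 then (tl k i * a (k + i%:R)%R)%g else 1%g.

Lemma tlD k i j : tl k (i + j) = (tl k i * tl (k + i%:R) j)%g.
Proof.
elim: j => [|j IH]; first by rewrite addn0 mulg1.
by rewrite addnS /= IH mulgA -addrA -natrD.
Qed.

Lemma tl5 k : tl k 5 = (a k * a (k + 1)%R * a (k + 2)%R * a (k + 3)%R * a (k + 4)%R)%g.
Proof. by rewrite /= mul1g addr0. Qed.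

Lemma natr5 (k : 'I_5) (j : nat) : k + (j + 5)%:R = k + j%:R.
Proof. by rewrite natrD addrA (_ : 5%:R = 0) ?addr0 //; apply: val_inj. Qed.

Lemma val_natr5 n : val (n%:R : 'I_5) = (n %% 5)%N.
Proof.
elim: n => [//|n IH]; rewrite -natr1.
by transitivity ((val (n%:R : 'I_5) + 1) %% 5)%N => //; rewrite IH modnDml addn1.
Qed.

Lemma tl10 k : tl k 10 = 1%g.
Proof.
rewrite (tlD k 5 5) (natr5 k 0) addr0 tl5.
by have := glue_cornerK a k; rewrite expgS expg1.
Qed.

Lemma tlP k j : tl k (j + 10) = tl k j.
Proof. by rewrite addnC tlD tl10 mul1g (natr5 k 5) (natr5 k 0) addr0. Qed.

(** Steps j and j + 5 around a corner show the same vertex number; they are told apart only by their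
    tiles, thanks to [glue_corner]. *)
Lemma tl_add5 k j : tl k (j + 5) != tl k j.
Proof.
rewrite addnC tlD (natr5 k 0) addr0 tl5 -{2}[tl k j]mul1g (inj_eq (mulIg _)).
exact: glue_corner.
Qed.

(** With this impredicative encoding, a gluing class is bounded by exhibiting a closed set that
    contains one of its points. *)
Definition steps_closed (S : set (H * V)) := forall t z l,
  P z -> nf l z = 0 -> S (t, z) -> S ((t * a l)%g, half l *m z).

(* The equivalence relation generated by the gluings of the sides. *)
Definition glued (u w : H * V) := forall S, steps_closed S -> S u -> S w.

Lemma glued_refl u : glued u u. Proof. by []. Qed.

Lemma glued_trans u v' w : glued u v' -> glued v' w -> glued u w.
Proof. by move=> uv vw S cS Su; apply: vw => //; exact: uv. Qed.

Lemma glued_step t z l : P z -> nf l z = 0 -> glued (t, z) ((t * a l)%g, half l *m z).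
Proof. by move=> Pz z0 S cS; exact: cS. Qed.

Lemma halfKv l (z : V) : half l *m (half l *m z) = z.
Proof. by rewrite mulmxA mulmxE halfK mul1mx. Qed.

Lemma glued_step_sym t z l : P z -> nf l z = 0 -> glued ((t * a l)%g, half l *m z) (t, z).
Proof.
move=> Pz z0; have [Pz' z0'] := half_side Pz z0.
by have := @glued_step (t * a l)%g _ _ Pz' z0'; rewrite -mulgA glue_inv mulg1 halfKv.
Qed.

(** Only forward steps generate the relation, but crossing the same side twice undoes a step. *)
Lemma glued_sym u w : P u.2 -> glued u w -> glued w u.
Proof.
move=> Pu uw; suff [] : [set w | P w.2 /\ glued w u] w by [].
apply: uw; last by split.
move=> t z l Pz z0 [_ h]; split; first by have [] := half_side Pz z0.
by apply: glued_trans h; exact: glued_step_sym.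
Qed.

(* (true, k) stands for a disc about the k-th vertex, which meets ten tiles, and *)
(* (false, k) for a neighbourhood of the open k-th side, which meets two.        *)
Definition sheets (c : bool * 'I_5) := if c.1 then 10%N else 2%N.

(** The domain of a side is invariant under the half turn about its midpoint and avoids the other
    sides of both adjacent tiles. *)
Definition dom (c : bool * 'I_5) : set V := if c.1 then vball c.2 else
  [set z | forall l, l != c.2 -> 0 < nf l z /\ 0 < nf l (half c.2 *m z)].

Lemma open_nf_gt0 l : open [set z : V | 0 < nf l z].
Proof. exact: ((continuousP _).1 (@continuous_nf R l) _ (@open_gt R 0)). Qed.

Lemma open_dom c : open (dom c).
Proof.
case: c => [[] k]; rewrite /dom /=.
  have -> : vball k = (lorentz (v k) @^-1` [set x | - (9 / 8) < x] : set V).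
    by apply/seteqP; split=> z; rewrite /vball /= ltrNl.
  exact: ((continuousP _).1 (@continuous_lorentz R (v k)) _ (@open_gt R _)).
rewrite openE => z /= hz.
pose f l := [set y : V | l != k -> 0 < nf l y /\ 0 < nf l (half k *m y)].
apply: (@filter_forall V 'I_5 f (nbhs z)) => l.
have [->|lk] := eqVneq l k.
  have -> : f k = setT by apply/seteqP; split=> // y _; rewrite /f /= eqxx.
  exact: filterT.
have [h1 h2] := hz l lk.
have n1 : nbhs z [set y : V | 0 < nf l y] by apply: open_nbhs_nbhs; split=> //; exact: open_nf_gt0.
have n2 : nbhs z ((fun y : V => half k *m y) @^-1` [set y : V | 0 < nf l y]).
  apply: open_nbhs_nbhs; split; last exact: h2.
  by have /continuousP := @continuous_mulmx R (half k); apply; exact: open_nf_gt0.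
by apply: filterS (filterI n1 n2) => y [y1 y2] _; split.
Qed.

Lemma dom_cover c (x : V) : hplane x -> dom c x ->
  exists j z, [/\ (j < sheets c)%N, P z & wmx c.2 j *m z = x].
Proof.
case: c => [[] k] hx; rewrite /dom /sheets /=; first exact: corner_cover.
move=> h; have [k0|k0] := leP 0 (nf k x).
  exists 0%N, x; rewrite mul1mx; split=> //; apply/pentagonP; split=> // l.
  by have [->//|lk] := eqVneq l k; have [/ltW] := h l lk.
exists 1%N, (half k *m x); rewrite /= addr0 mul1r halfKv; split=> //.
have [_ _ hh] := hisometry_half R k.
apply/pentagonP; split=> [|l]; first exact: hh.
have [->|lk] := eqVneq l k; last by have [_ /ltW] := h l lk.
by have [-> _ _ _ _] := nf_half k x; rewrite oppr_ge0 ltW.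
Qed.

Lemma wmxS k j l : l = k + j%:R -> wmx k j.+1 * half l = wmx k j.
Proof. by move=> ->; rewrite /= -mulrA halfK mulr1. Qed.

Lemma vball_wmx k j (z : V) : P z -> vball k (wmx k j *m z) -> vball (k + j%:R) z.
Proof.
have [y ->] := rhoX_surj j z => _; rewrite mulmxA mulmxE wmx_rho vball_sigX.
by elim: j => [|j IH] hb; [rewrite addr0 mul1mx|
  rewrite -natr1 addrA exprS -mulmxE -mulmxA vball_rho; exact: IH].
Qed.

(** A gluing step inside a chart leads to another sheet and leaves the unfolded point unchanged. In
    a disc only the two sides at the vertex can be crossed, leading to the next or the previous
    sheet modulo 10. *)
Lemma dom_step c j (z : V) l : (j < sheets c)%N -> P z -> dom c (wmx c.2 j *m z) ->
  nf l z = 0 -> exists j', [/\ (j' < sheets c)%N, tl c.2 j' = (tl c.2 j * a l)%g &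
    wmx c.2 j' * half l = wmx c.2 j].
Proof.
case: c => [[] k]; rewrite /dom /sheets /= => jc Pz hd z0; last first.
  case: j jc hd => [|[|//]] _; rewrite ?mul1mx /= ?addr0 ?mul1r => hd.
    have [->|lk] := eqVneq l k; last by have [] := hd l lk; rewrite z0 ltxx.
    by exists 1%N; rewrite /= addr0 mul1r halfK.
  have [->|lk] := eqVneq l k.
    by exists 0%N; rewrite /= mul1r !mul1g glue_inv.
  by have [_] := hd l lk; rewrite halfKv z0 ltxx.
have hb := vball_wmx Pz hd; have /pentagonP[hz _] := Pz.
have [_ _ h] := vball_nf hz hb.
have [e|lj] := eqVneq l (k + j%:R).
  have hS : wmx k j.+1 * half l = wmx k j /\ tl k j.+1 = (tl k j * a l)%g.
    by rewrite wmxS // e.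
  (* The sheet after the last one is the first. *)
  have [j9|j9] := eqVneq j 9%N.
    exists 0%N; move: hS; rewrite j9 => -[<- <-].
    by rewrite (wmx10 R k 0) (tlP k 0).
  exists j.+1; case: hS => -> ->; split=> //.
  by rewrite ltn_neqAle jc andbT -(eqSS j 9) in j9 *.
have [e|lj4] := eqVneq l (k + j%:R + 4); last by have := h l lj lj4; rewrite z0; lra.
have hS i : j = i.+1 -> wmx k i * half l = wmx k j /\ tl k i = (tl k j * a l)%g.
  move=> ji; have el : l = k + i%:R.
    rewrite e ji -natr1 -addrA -addrA -[in RHS](addr0 i%:R); congr (_ + (_ + _)).
    exact: val_inj.
  by rewrite ji /= -el -mulgA glue_inv mulg1.
case: j jc hd hb h lj e hS => [|j] jc hd hb h lj e hS.
  have {}e : l = k + 9%:R by rewrite e -addrA; congr (_ + _); apply: val_inj.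
  exists 9%N; rewrite e; split=> //; last exact: (wmx10 R k 0).
  by apply: (mulIg (a (k + 9%:R))); rewrite -[RHS]mulgA glue_inv mulg1; exact: tl10.
by exists j; have [//|-> ->] := hS j; split=> //; exact: ltnW.
Qed.

(** A tile may occur in several sheets, but then through different points. For a disc the point
    determines the vertex, hence i and j modulo 5, and [tl_add5] excludes a difference of 5. *)
Lemma dom_uniq c i j (z : V) : (i < sheets c)%N -> (j < sheets c)%N -> P z ->
  dom c (wmx c.2 i *m z) -> dom c (wmx c.2 j *m z) -> tl c.2 i = tl c.2 j -> i = j.
Proof.
case: c => [[] k]; rewrite /dom /sheets /= => ic jc Pz; last first.
  have n1 : a (k + 0) != 1%g by exact: glue_neq1.
  case: i j ic jc => [|[|//]] [|[|//]] //= _ _ _ _; rewrite mul1g => e.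
    by rewrite -e eqxx in n1.
  by rewrite e eqxx in n1.
move=> /(vball_wmx Pz) hi /(vball_wmx Pz) hj e.
have /pentagonP[hz _] := Pz.
have /addrI/(congr1 val) := vball_inj hz hi hj; rewrite !val_natr5 => ij.
have [ij'|ji|//] := ltngtP i j.
  have ej : j = (i + 5)%N by lia.
  by have := tl_add5 k i; rewrite -ej e eqxx.
have ei : i = (j + 5)%N by lia.
by have := tl_add5 k j; rewrite -ei e eqxx.
Qed.

Lemma hisometry_inj (A : 'M[R]_3) (z w : V) : hisometry A -> A *m z = A *m w -> z = w.
Proof.
move=> [_ dA _] /(congr1 (mulmx (invmx A))).
by rewrite !mulKmx // unitmxE dA unitr1.
Qed.

Lemma corner_step k j t (x y : V) : P x -> nf k x = 0 -> x = sig k *m y ->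
  glued ((t * tl k j)%g, rho ^+ j *m x) ((t * tl k j.+1)%g, rho ^+ j.+1 *m y).
Proof.
move=> Px x0 e; have Pz : P (rho ^+ j *m x) by apply/pentagon_rhoX.
have z0 : nf (k + j%:R) (rho ^+ j *m x) = 0 by rewrite nf_rhoX.
have := glued_step (t := (t * tl k j)%g) Pz z0.
have hx : half k *m x = rho *m y by rewrite e /sig -mulmxE -mulmxA halfKv.
by rewrite -mulgA mulmxA mulmxE half_rhoX -mulmxE -mulmxA hx mulmxA mulmxE -exprSr.
Qed.

(** Sheets overlap only where [sector_unique] allows it. On a common side one gluing step suffices;
    at the vertex one walks through all sheets in between. *)
Lemma dom_glued_le c t i j (z w : V) : (i <= j)%N -> (j < sheets c)%N -> P z -> P w ->
  dom c (wmx c.2 i *m z) -> wmx c.2 i *m z = wmx c.2 j *m w ->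
  glued ((t * tl c.2 i)%g, z) ((t * tl c.2 j)%g, w).
Proof.
have [->|ij] := eqVneq i j.
  by move=> _ _ _ _ _ /(hisometry_inj (hisometry_wmx R _ _)) ->; exact: glued_refl.
case: c => [[] k] ji; rewrite /dom /sheets /= => jc Pz Pw; last first.
  case: i j ij ji jc => [|[|i]] [|[|j]] //= _ _ _; rewrite addr0 !mul1r mul1mx mul1g mulg1.
  move=> _ e; have z0 : nf k z = 0.
    apply/eqP; rewrite eq_le; have /pentagonP[_ ->] := Pz; rewrite andbT e.
    have [-> _ _ _ _] := nf_half k w; rewrite oppr_le0.
    by have /pentagonP[_ ->] := Pw.
  by have := glued_step (t := t) Pz z0; rewrite {2}e halfKv.
have [y ez] := rhoX_surj i z; have [x ew] := rhoX_surj j w.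
rewrite ez ew !mulmxA !mulmxE !wmx_rho => hb e.
have Py : P y by apply/(pentagon_rhoX i); rewrite -ez.
have Px : P x by apply/(pentagon_rhoX j); rewrite -ew.
have eyx : y = sig k ^+ (j - i) *m x.
  apply: (@hisometry_inj (sig k ^+ i)).
    exact: hisometryX (hisometryM (hisometry_half R k) (hisometry_rho R)).
  by rewrite e mulmxA mulmxE -exprD subnKC.
have /pentagonP[_ hy] := Py; have /pentagonP[_ hx] := Px.
have d10 : (j - i < 10)%N by apply: leq_ltn_trans jc; exact: leq_subr.
have [d0|[d1 x0]|[d9 y0]|[x0 x4 xy]] :=
  sector_unique d10 eyx (hy k) (hy (k + 4)) (hx k) (hx (k + 4)).
- by exfalso; lia.
- have -> : j = i.+1 by lia.
  rewrite d1 expr1 in eyx; apply: corner_step => //.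
  by rewrite eyx; have [-> _] := nf_sig k x; rewrite x0 oppr0.
(* The last sheet is adjacent to the first: a tenth step returns to the initial tile by [tl10]. *)
- have i0 : i = 0%N by lia.
  have j9 : j = 9%N by lia.
  rewrite i0 j9; rewrite d9 in eyx.
  have exy : x = sig k *m y by rewrite eyx mulmxA mulmxE -exprS sig10 mul1mx.
  have x0 : nf k x = 0 by rewrite exy; have [-> _] := nf_sig k y; rewrite y0 oppr0.
  have := @corner_step k 9 t x y Px x0 exy; rewrite rho10 mul1mx tl10 => g.
  by apply: glued_sym g => /=; apply/pentagon_rhoX.
- have ex : x = sig k *m x.
    by have := nf_corner0 x0 x4 => ex; rewrite {2}ex -scalemxAr sig_v -ex.
  have h m : glued ((t * tl k i)%g, rho ^+ i *m x) ((t * tl k (i + m))%g, rho ^+ (i + m) *m x).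
    elim: m => [|m IH]; first by rewrite addn0; exact: glued_refl.
    by apply: glued_trans IH _; rewrite addnS; exact: corner_step.
  by rewrite xy -(subnKC ji); exact: h.
Qed.

Lemma dom_glued c t i j (z w : V) : (i < sheets c)%N -> (j < sheets c)%N -> P z -> P w ->
  dom c (wmx c.2 i *m z) -> wmx c.2 i *m z = wmx c.2 j *m w ->
  glued ((t * tl c.2 i)%g, z) ((t * tl c.2 j)%g, w).
Proof.
move=> ic jc Pz Pw hd e; have [ij|/ltnW ji] := leqP i j; first exact: dom_glued_le.
by apply: glued_sym => //; apply: dom_glued_le => //; rewrite -e.
Qed.

Lemma pentagon_dom (z : V) : P z -> exists c, dom c z.
Proof.
move=> Pz; have /pentagonP[hz hn] := Pz.
have v_dom k : z = v k -> exists c, dom c z.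
  move=> ->; exists (true, k); rewrite /dom /vball /=.
  by have [-> _] := hplane_v R k; lra.
have [[k k0]|n0] := pselect (exists k, nf k z = 0).
  have [zk|/v_dom//|/v_dom//] := side_cases Pz k0.
  exists (false, k) => l lk; split; first exact: side_open_pos zk _ lk.
  exact: side_open_pos (half_side_open zk) _ lk.
have h l : 0 < nf l z.
  by rewrite lt_neqAle hn andbT eq_sym; apply/eqP => l0; apply: n0; exists l.
have g := golden_gt0 R; have [_ e1 e2 e3 e4] := nf_half 0 z.
(* An interior point lies in the domain of every side; side 0 is an arbitrary choice. *)
exists (false, 0); rewrite /dom /=; apply: ord5_case => //; move=> _; split=> //.
- by move: e1; rewrite add0r => ->; rewrite addr_gt0 // mulr_gt0.
- by move: e2; rewrite add0r => ->; rewrite addr_gt0 // mulr_gt0 //; lra.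
- by move: e3; rewrite add0r => ->; rewrite addr_gt0 // mulr_gt0 //; lra.
- by move: e4; rewrite add0r => ->; rewrite addr_gt0 // mulr_gt0.
Qed.

End Gluing.

(** * The glued surface *)

(** A point is a gluing class taken as a set, so equivalent representatives give equal points by
    extensionality. *)
Definition surface (R : realType) (H : finGroupType) (a : gluing H) : Type :=
  {S : set (H * 'cV[R]_3) | exists u, @hpolygon R 5 10 u.2 /\ S = glued a u}.

HB.instance Definition _ R H a := gen_eqMixin (@surface R H a).
HB.instance Definition _ R H a := gen_choiceMixin (@surface R H a).

Section SurfacePoints.
Variables (R : realType) (H : finGroupType) (a : gluing H).
Local Notation v := (@hvertex R 5 10).
Local Notation V := 'cV[R]_3.
Local Notation P := (@hpolygon R 5 10).
Local Notation X := (surface R a).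

(* The value at points outside the pentagon is irrelevant. *)
Definition clamp (z : V) : V := if pselect (P z) then z else v 0.

Lemma clamp_pentagon z : P (clamp z).
Proof. by rewrite /clamp; case: (pselect (P z)) => [//|?]; exact: v_pentagon. Qed.

Lemma clampE z : P z -> clamp z = z.
Proof. by rewrite /clamp; case: (pselect (P z)). Qed.

Definition cls (t : H) (z : V) : X :=
  exist _ (glued a (t, clamp z)) (ex_intro _ (t, clamp z) (conj (clamp_pentagon z) erefl)).

Lemma cls_eqP t u z w : P z -> P w -> cls t z = cls u w <-> glued a (t, z) (u, w).
Proof.
move=> Pz Pw; split=> [/(congr1 sval)|h].
  rewrite /= !clampE // => e; have : glued a (u, w) (u, w) by exact: glued_refl.
  by rewrite -e.
apply: eq_exist; rewrite /= !clampE //; apply/funext => x; apply/propext; split.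
  by apply: glued_trans; exact: glued_sym h.
exact: glued_trans.
Qed.

Lemma cls_surj (x : X) : exists t z, P z /\ x = cls t z.
Proof.
case: x => S hS; have [[t z] [/= Pz e]] := hS; exists t, z; split=> //.
by apply: eq_exist; rewrite /= clampE.
Qed.

(** The quotient topology of a disjoint union of pentagons. *)
Definition surface_open : set_system X :=
  [set W | forall t, open ([set z | W (cls t z)] : set (subspace P))].

Lemma surface_openT : surface_open setT.
Proof. by move=> t; exact: openT. Qed.

Lemma surface_openI : setI_closed surface_open.
Proof. by move=> A B oA oB t; exact: openI (oA t) (oB t). Qed.

Lemma surface_open_bigU I (f : I -> set X) :
  (forall i, surface_open (f i)) -> surface_open (\bigcup_i f i).
Proof.
move=> h t; have := bigcup_open (D := setT) (fun i _ => h i t).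
by congr open; apply/seteqP; split=> z [i _ fi]; exists i.
Qed.

End SurfacePoints.

HB.instance Definition _ R H a := isOpenTopological.Build (@surface R H a)
  (@surface_openT R H a) (@surface_openI R H a) (@surface_open_bigU R H a).

(** * Quotient topology and charts *)

Section SurfaceTopology.
Variables (R : realType) (H : finGroupType) (a : gluing H).
Local Notation v := (@hvertex R 5 10).
Local Notation V := 'cV[R]_3.
Local Notation P := (@hpolygon R 5 10).
Local Notation X := (surface R a).
Local Notation half := (half R).
Local Notation wmx := (wmx R).
Local Notation cls := (@cls R H a).
Local Notation tl := (tl a).

Lemma open_surfaceP (W : set X) : open W <->
  forall t, open ([set z | W (cls t z)] : set (subspace P)).
Proof. by []. Qed.

(** Open and closed sets of the quotient are described tile by tile, by families compatible with the
    gluing steps. *)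
Definition saturation (O : H -> set V) : set X :=
  [set x | exists t z, [/\ P z, O t z & x = cls t z]].

Definition saturated (O : H -> set V) := forall t z l,
  P z -> nf l z = 0 -> O t z -> O (t * a l)%g (half l *m z).

Lemma saturationE O t z : saturated O -> P z -> saturation O (cls t z) <-> O t z.
Proof.
move=> sO Pz; split=> [[u [w [Pw Ow /esym/cls_eqP -/(_ Pw Pz) h]]]|Otz].
  by apply: (h [set x | O x.1 x.2]) Ow => t' z' l; exact: sO.
by exists t, z.
Qed.

Lemma open_saturation O : saturated O -> (forall t, open (O t : set (subspace P))) ->
  open (saturation O).
Proof.
move=> sO oO; apply/open_surfaceP => t; have /open_subspaceP[W oW e] := oO t.
apply/open_subspaceP; exists W => //; rewrite e; apply/seteqP; split=> z [h Pz].
  by split=> //; apply/(saturationE _ sO Pz).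
by split=> //; apply/(saturationE _ sO Pz).
Qed.

Lemma closed_saturation O : saturated O -> (forall t, closed (O t : set (subspace P))) ->
  closed (saturation O).
Proof.
move=> sO cO; rewrite -openC; apply/open_surfaceP => t.
have /closed_subspaceP[W cW e] := cO t; apply/open_subspaceP; exists (~` W).
  by rewrite openC.
apply/seteqP; split=> z [h Pz]; split=> //.
  move=> /(saturationE _ sO Pz) Oz; apply: h.
  by have : (O t `&` P) z by []; rewrite -e => -[].
move=> Wz; apply: h; apply/(saturationE _ sO Pz).
by have : (W `&` P) z by []; rewrite e => -[].
Qed.

Lemma cls_continuous t : {within P, continuous (cls t)}.
Proof. by apply/continuousP => W /open_surfaceP oW; exact: oW. Qed.

(* The chart (t0, c) unfolds the sheets c tiles around a corner or a side of  *)
(* the tile t0.                                                               *)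
Definition chart_dom (t0 : H) c : set X := [set x | exists j z,
  [/\ (j < sheets c)%N, P z, dom c (wmx c.2 j *m z) & x = cls (t0 * tl c.2 j)%g z]].

Definition chart (t0 : H) c (x : X) : V := xget 0 [set p | exists j z,
  [/\ (j < sheets c)%N, P z, dom c (wmx c.2 j *m z), x = cls (t0 * tl c.2 j)%g z
    & p = wmx c.2 j *m z]].

Definition chart_pre (t0 : H) c (Q : set V) : H -> set V := fun t => [set z |
  exists j, [/\ (j < sheets c)%N, t = (t0 * tl c.2 j)%g,
    dom c (wmx c.2 j *m z) & Q (wmx c.2 j *m z)]].

Lemma saturated_chart_pre t0 c Q : saturated (chart_pre t0 c Q).
Proof.
move=> t z l Pz z0 [j [jc -> hd hQ]]; have [i [ic ti wi]] := dom_step a jc Pz hd z0.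
have e : wmx c.2 i *m (half l *m z) = wmx c.2 j *m z by rewrite mulmxA mulmxE wi.
by exists i; rewrite e ti mulgA.
Qed.

(** Independence of the representative: having a given unfolded point is preserved by gluing steps
    ([saturated_chart_pre]), and [dom_uniq] identifies the sheet. *)
Lemma chartE t0 c j z : (j < sheets c)%N -> P z -> dom c (wmx c.2 j *m z) ->
  chart t0 c (cls (t0 * tl c.2 j)%g z) = wmx c.2 j *m z.
Proof.
move=> jc Pz hd; rewrite /chart.
set A := [set p | _]; have : A (xget 0 A).
  by apply: xgetPex; exists (wmx c.2 j *m z), j, z.
move=> [i [w [ic Pw hdw ecls ->]]]; move: ecls => /esym/cls_eqP -/(_ Pw Pz) h.
have [||k [/= kc e hdk <-]] := h [set x | chart_pre t0 c [set p | p = wmx c.2 i *m w] x.1 x.2].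
- by move=> t' z' l; exact: saturated_chart_pre.
- by exists i.
- by move: e => /mulgI e; rewrite (dom_uniq (a := a) jc kc Pz hd hdk e).
Qed.

Lemma chart_domE t0 c : chart_dom t0 c = saturation (chart_pre t0 c setT).
Proof.
apply/seteqP; split=> x.
  by move=> [j [z [jc Pz hd ->]]]; exists (t0 * tl c.2 j)%g, z; split=> //; exists j.
by move=> [t [z [Pz [j [jc -> hd _]] ->]]]; exists j, z.
Qed.

Lemma chart_dom_preE t0 c Q : chart_dom t0 c `&` chart t0 c @^-1` Q =
  saturation (chart_pre t0 c Q).
Proof.
apply/seteqP; split=> x.
  move=> [[j [z [jc Pz hd ->]]]]; rewrite /= chartE // => hQ.
  by exists (t0 * tl c.2 j)%g, z; split=> //; exists j.
move=> [t [z [Pz [j [jc -> hd hQ]] ->]]]; split; first by exists j, z.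
by rewrite /= chartE.
Qed.

Lemma open_preimage_mulmx (A : 'M[R]_3) (Q : set V) :
  open Q -> open ((fun z => A *m z) @^-1` Q).
Proof. by move=> oQ; have /continuousP := @continuous_mulmx R A; apply. Qed.

Lemma open_chart_pre t0 c Q t : open Q -> open (chart_pre t0 c Q t).
Proof.
move=> oQ; have -> : chart_pre t0 c Q t = \bigcup_(j in [set j | (j < sheets c)%N /\
    t = (t0 * tl c.2 j)%g]) ((fun z => wmx c.2 j *m z) @^-1` (dom c `&` Q)).
  apply/seteqP; split=> z; first by move=> [j [jc tj hd hQ]]; exists j.
  by move=> [j [jc tj] [hd hQ]]; exists j.
by apply: bigcup_open => j _; apply: open_preimage_mulmx; apply: openI => //; exact: open_dom.
Qed.

Lemma open_chart_dom_pre t0 c Q : open Q -> open (chart_dom t0 c `&` chart t0 c @^-1` Q).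
Proof.
move=> oQ; rewrite chart_dom_preE; apply: open_saturation => [|t].
  exact: saturated_chart_pre.
by apply: open_subspaceW; exact: open_chart_pre.
Qed.

Lemma open_chart_dom t0 c : open (chart_dom t0 c).
Proof. by have := @open_chart_dom_pre t0 c _ openT; rewrite preimage_setT setIT. Qed.

Lemma chart_inj t0 c : {in chart_dom t0 c &, injective (chart t0 c)}.
Proof.
move=> x y /set_mem[i [z [ic Pz hz ->]]] /set_mem[j [w [jc Pw hw ->]]].
rewrite !chartE // => e; apply/cls_eqP => //; exact: dom_glued.
Qed.

Lemma closed_pentagon : closed P.
Proof.
have -> : P = (fun z : V => lorentz z z) @^-1` [set -1] `&`
    ((fun z : V => z 2 0) @^-1` [set x | 0 <= x] `&`
     \bigcap_(k : 'I_5) (nf k @^-1` [set x | 0 <= x])).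
  apply/seteqP; split=> z.
    move=> /pentagonP[[h1 h0] h]; split; first exact: h1.
    by split; [exact: ltW|move=> k _; exact: h].
  move=> [/= h1 [h0 h]]; apply/pentagonP; split; last by move=> k; exact: h.
  (* The strict inequality comes for free: a vector of height 0 has nonnegative Lorentz square. *)
  split=> //; rewrite lt_neqAle h0 andbT eq_sym; apply/eqP => z0; move: h1.
  rewrite /lorentz z0 mul0r subr0 => h1; have := sqr_ge0 (z 0 0); have := sqr_ge0 (z 1 0).
  by rewrite !expr2; lra.
have cz (k : 'I_3) : continuous (fun z : V => z k 0) by exact: coord_continuous.
apply: closedI; last apply: closedI; last apply: closed_bigI => k _.
- apply: preimage_closed; last exact: closed_eq.
  move=> z _; rewrite /lorentz.
  have c k : (fun y : V => y k 0 * y k 0) @ z --> z k 0 * z k 0 by exact: (cvgM (cz k z) (cz k z)).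
  exact: (cvgB (cvgD (c 0) (c 1)) (c 2)).
- by apply: preimage_closed; [move=> z _; exact: cz|exact: closed_ge].
- by apply: preimage_closed; [move=> z _; exact: continuous_nf|exact: closed_ge].
Qed.

Lemma surface_chart t0 c : is_chart (chart_dom t0 c) (chart t0 c).
Proof.
split.
- exact: open_chart_dom.
- rewrite continuous_open_subspace; last exact: open_chart_dom.
  by apply/continuous_inP => [|Q]; [exact: open_chart_dom|exact: open_chart_dom_pre].
- exact: chart_inj.
- move=> _ [x [j [z [jc Pz hd ->]]] <-]; rewrite chartE //.
  by have [_ _ h] := hisometry_wmx R c.2 j; apply: h; have /pentagonP[] := Pz.
move=> W /open_surfaceP oW WU.
have [Q oQ QE] : exists2 Q : H -> set V, (forall t, open (Q t)) &
    forall t z, P z -> (Q t z <-> W (cls t z)).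
  have h0 : forall t, exists Q : set V, open Q /\ forall z, P z -> (Q z <-> W (cls t z)).
    move=> t; have /open_subspaceP[Q oQ e] := oW t; exists Q; split=> // z Pz.
    split=> h; first by have : (Q `&` P) z by []; rewrite e => -[].
    by have : ([set z | W (cls t z)] `&` P) z by []; rewrite -e => -[].
  by have [Q hQ] := choice h0; exists Q => t; case: (hQ t).
pose inv j : 'M[R]_3 := invmx (wmx c.2 j).
have invK j z : inv j *m (wmx c.2 j *m z) = z.
  by have [_ dA _] := hisometry_wmx R c.2 j; rewrite mulKmx // unitmxE dA unitr1.
(* Unfolded points of the j-th tile that lie outside [W]. They form a closed set, and removing these
   finitely many sets from [dom c] leaves the image of [W]. *)
pose bad j := (fun x => inv j *m x) @^-1` (P `&` ~` Q (t0 * tl c.2 j)%g).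
exists (dom c `&` ~` \bigcup_(j in [set j | (j < sheets c)%N]) bad j).
  apply: openI; first exact: open_dom.
  rewrite openC; apply: closed_bigcup; first exact: finite_II.
  move=> j _; apply: preimage_closed; first by move=> x _; exact: continuous_mulmx.
  by apply: closedI; [exact: closed_pentagon|rewrite closedC].
apply/seteqP; split=> x.
  move=> [y Wy <-]; have [j [z [jc Pz hd ey]]] := WU _ Wy.
  rewrite ey in Wy *; rewrite chartE //; have hz : hplane z by have /pentagonP[] := Pz.
  split; last by have [_ _ h] := hisometry_wmx R c.2 j; exact: h.
  split=> // -[i /= ic [Pi]]; apply; apply/QE => //.
  suff <- : cls (t0 * tl c.2 j)%g z = cls (t0 * tl c.2 i)%g (inv i *m (wmx c.2 j *m z)) by [].
  apply/cls_eqP => //; apply: dom_glued => //.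
  rewrite /inv mulKVmx //; have [_ dA _] := hisometry_wmx R c.2 i.
  by rewrite unitmxE dA unitr1.
move=> [[hd hb] hx]; have [j [z [jc Pz ez]]] := dom_cover hx hd.
exists (cls (t0 * tl c.2 j)%g z); last by rewrite chartE ?ez.
apply/QE => //; apply: contrapT => nO; apply: hb; exists j => //.
by rewrite /bad /= -ez invK.
Qed.

Lemma chart_cover (x : X) : exists t0 c, chart_dom t0 c x.
Proof.
have [t [z [Pz ->]]] := cls_surj x; have [c hc] := pentagon_dom Pz.
exists t, c, 0%N, z; rewrite mul1mx mulg1; split=> //.
by case: (c) => [[]].
Qed.

End SurfaceTopology.

(** * Transition maps, sides and corners *)

Section SurfaceGeometry.
Variables (R : realType) (H : finGroupType) (a : gluing H).
Local Notation v := (@hvertex R 5 10).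
Local Notation V := 'cV[R]_3.
Local Notation P := (@hpolygon R 5 10).
Local Notation X := (surface R a).
Local Notation half := (half R).
Local Notation wmx := (wmx R).
Local Notation cls := (@cls R H a).
Local Notation tl := (tl a).

Lemma hisometry_inv (A : 'M[R]_3) : hisometry A -> exists2 B, hisometry B & B * A = 1.
Proof.
move=> [hA dA fA]; have uA : A \in unitmx by rewrite unitmxE dA unitr1.
exists (invmx A); last exact: mulVmx.
have hB u w : lorentz (invmx A *m u) (invmx A *m w) = lorentz u w by rewrite -hA !mulKVmx.
split=> // [|z hz]; first by rewrite det_inv dA invr1.
have [z1 z0] := hz; split; first by rewrite hB.
set w := invmx A *m z; have [//|w0] := ltP 0 (w 2 0).
have Aw : A *m w = z by rewrite mulKVmx.
have w1 : lorentz w w = -1 by rewrite hB.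
(* If [w] were on the lower sheet, [A] would send [- w], on the upper sheet, to [- z] on the lower
   one. *)
have hw : hplane (- w).
  split; first by rewrite -scaleN1r lorentzZl lorentzZr w1; ring.
  rewrite mxE oppr_gt0 lt_neqAle w0 andbT; apply/eqP => w20; move: w1.
  rewrite /lorentz w20 mul0r subr0 => h1; have := sqr_ge0 (w 0 0); have := sqr_ge0 (w 1 0).
  by rewrite !expr2; lra.
by have [_] := fA _ hw; rewrite mulmxN Aw mxE; lra.
Qed.

Lemma chart_dom_clsE t0 c t z : P z -> chart_dom (a := a) t0 c (cls t z) <->
  exists j, [/\ (j < sheets c)%N, t = (t0 * tl c.2 j)%g & dom c (wmx c.2 j *m z)].
Proof.
move=> Pz; rewrite chart_domE (saturationE _ (@saturated_chart_pre R H a t0 c setT) Pz).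
by split=> [[j []]|[j []]] *; exists j.
Qed.

(** On two given sheets the transition is a fixed matrix. By [dom_step] in both charts, this matrix
    does not change when passing to an adjacent tile, so the points where it applies form an open
    saturated set [O]. *)
Lemma surface_transition t0 c t1 d (x : X) : chart_dom t0 c x -> chart_dom t1 d x ->
  exists2 A, hisometry A & \forall y \near x, chart t1 d y = A *m chart t0 c y.
Proof.
move=> [j [z [jc Pz hj ->]]] /(chart_dom_clsE _ _ _ Pz)[i [id ti hi]].
have [B hB BA] := hisometry_inv (hisometry_wmx R c.2 j).
exists (wmx d.2 i * B); first exact: hisometryM (hisometry_wmx R _ _) hB.
pose A := wmx d.2 i * B.
pose O := fun t => [set z | exists j i, [/\ (j < sheets c)%N, (i < sheets d)%N,
  t = (t0 * tl c.2 j)%g /\ t = (t1 * tl d.2 i)%g,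
  dom c (wmx c.2 j *m z) /\ dom d (wmx d.2 i *m z) & wmx d.2 i = A * wmx c.2 j]].
have sO : saturated a O.
  move=> t y l Py y0 [j' [i' [jc' id' [tj ti'] [hj' hi'] e]]].
  have [j'' [jc'' tj'' wj]] := dom_step a jc' Py hj' y0.
  have [i'' [id'' ti'' wi]] := dom_step a id' Py hi' y0.
  have ej : wmx c.2 j'' *m (half l *m y) = wmx c.2 j' *m y by rewrite mulmxA mulmxE wj.
  have ei : wmx d.2 i'' *m (half l *m y) = wmx d.2 i' *m y by rewrite mulmxA mulmxE wi.
  exists j'', i''; rewrite ej ei; split=> //.
    by rewrite tj'' ti'' !mulgA -tj -ti'.
  have h2 : half l * half l = 1 by exact: halfK.
  by rewrite -[wmx d.2 i'']mulr1 -h2 mulrA wi e -wj mulrA -mulrA h2 mulr1.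
have oO : open (saturation (a := a) O).
  apply: open_saturation => // t; apply: open_subspaceW.
  have -> : O t = \bigcup_(k in [set k : nat * nat | [/\ (k.1 < sheets c)%N, (k.2 < sheets d)%N,
     t = (t0 * tl c.2 k.1)%g, t = (t1 * tl d.2 k.2)%g & wmx d.2 k.2 = A * wmx c.2 k.1]])
     ((fun z => wmx c.2 k.1 *m z) @^-1` dom c `&` (fun z => wmx d.2 k.2 *m z) @^-1` dom d).
    apply/seteqP; split=> y; first by move=> [j' [i' [? ? [? ?] [? ?] ?]]]; exists (j', i').
    by move=> [[j' i'] [/= ? ? ? ? ?] [? ?]]; exists j', i'.
  by apply: bigcup_open => k _; apply: openI; apply: open_preimage_mulmx; exact: open_dom.
have nO : nbhs (cls (t0 * tl c.2 j)%g z) (saturation (a := a) O).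
  apply: open_nbhs_nbhs; split=> //; apply/saturationE => //.
  by exists j, i; split=> //; rewrite /A -mulrA BA mulr1.
apply: filterS nO => y [t [w [Pw [j' [i' [jc' id' [tj ti'] [hj' hi'] e]]] ->]]].
by rewrite {2}tj {1}ti' !chartE // e mulmxA.
Qed.

Lemma surface_tile_isometry t0 c t (z : V) : P z -> chart_dom t0 c (cls t z) ->
  exists2 A, hisometry A & \forall w \near z, P w -> chart t0 c (cls t w) = A *m w.
Proof.
move=> Pz /(chart_dom_clsE _ _ _ Pz)[j [jc -> hd]].
exists (wmx c.2 j); first exact: hisometry_wmx.
have n : nbhs z ((fun y => wmx c.2 j *m y) @^-1` dom c).
  by apply: open_nbhs_nbhs; split=> //; apply: open_preimage_mulmx; exact: open_dom.
by apply: filterS n => w hw Pw; rewrite chartE.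
Qed.

(** No gluing step starts at an interior point, so its class is a singleton. *)
Lemma surface_interior t u (z w : V) : @hinterior R 5 10 z -> P w ->
  cls t z = cls u w -> t = u /\ z = w.
Proof.
move=> /[dup] -[Pz _] /interiorP[hz h] Pw /cls_eqP -/(_ Pz Pw) e.
have : [set x | x = (t, z)] (u, w).
  apply: e => // t' z' l _ z0 [_ ez]; have := h l.
  by rewrite -ez z0 ltxx.
by case=> -> ->.
Qed.

Lemma glued_side t u k (z w : V) : @hside_open R 5 10 k z -> glued a (t, z) (u, w) ->
  (u, w) = (t, z) \/ (u, w) = ((t * a k)%g, half k *m z).
Proof.
move=> hz g; apply: (g [set x | x = (t, z) \/ x = ((t * a k)%g, half k *m z)]); last by left.
move=> t' z' l Pz' z0' [[-> e]|[-> e]]; rewrite e in z0' *.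
  have [->|lk] := eqVneq l k; first by right.
  by have := side_open_pos hz lk; rewrite z0' ltxx.
have [->|lk] := eqVneq l k; first by left; rewrite -mulgA glue_inv mulg1 halfKv.
by have := side_open_pos (half_side_open hz) lk; rewrite z0' ltxx.
Qed.

Lemma surface_side_inj t k : {in @hside_open R 5 10 k &, injective (cls t)}.
Proof.
move=> z w /set_mem hz /set_mem hw /cls_eqP -/(_ (side_openW hz) (side_openW hw)).
move=> /(glued_side hz)[[->//]|[e _]].
by have := glue_neq1 a k; rewrite -(inj_eq (mulgI t)) mulg1 -e eqxx.
Qed.

Lemma cls_half t k (z : V) : P z -> nf k z = 0 -> cls t z = cls (t * a k)%g (half k *m z).
Proof.
move=> Pz z0; have [Pz' _] := half_side Pz z0.
by apply/cls_eqP => //; exact: glued_step.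
Qed.

Lemma side_image_step t k : cls t @` @hside R 5 10 k = cls (t * a k)%g @` @hside R 5 10 k.
Proof.
have h u : cls u @` @hside R 5 10 k `<=` cls (u * a k)%g @` @hside R 5 10 k.
  move=> _ [z /sideP[Pz z0] <-]; exists (half k *m z); last by rewrite -cls_half.
  by apply/sideP; exact: half_side.
apply/seteqP; split; first exact: h.
by have := h (t * a k)%g; rewrite -mulgA glue_inv mulg1.
Qed.

Lemma surface_side_meet t u k (z w : V) : @hside_open R 5 10 k z -> P w ->
  cls t z = cls u w -> exists2 l, @hside_open R 5 10 l w &
    cls t @` @hside R 5 10 k = cls u @` @hside R 5 10 l.
Proof.
move=> hz Pw /cls_eqP -/(_ (side_openW hz) Pw) /(glued_side hz)[[-> ->]|[-> ->]].
  by exists k.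
by exists k; [exact: half_side_open|exact: side_image_step].
Qed.

Lemma vertex_inj : injective v.
Proof.
have h k : vball k (v k) by rewrite /vball /=; have [-> _] := hplane_v R k; lra.
by move=> k l e; apply: (@vball_inj R k l (v k)); rewrite ?e //; rewrite -?e //; exact: hplane_v.
Qed.

Lemma wmx_v k j : wmx k j *m v (k + j%:R) = v k.
Proof.
elim: j => [|j IH]; first by rewrite addr0 mul1mx.
by rewrite /= -mulmxE -mulmxA -natr1 addrA half_vS.
Qed.

(** The class of a vertex is the set of points that the disc chart there sends to the centre, one
    for each of ten sheets. *)
Lemma cls_vertexE t k u l : cls u (v l) = cls t (v k) <->
  exists2 j, (j < 10)%N & (u, l) = ((t * tl k j)%g, k + j%:R).
Proof.
have dv : dom (true, k) (v k).
  by rewrite /dom /vball /=; have [-> _] := hplane_v R k; lra.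
split.
  move=> /esym/cls_eqP -/(_ (v_pentagon _ _) (v_pentagon _ _)) h.
  have [||j [/= j10 -> _ e]] := h [set x | chart_pre a t (true, k) [set v k] x.1 x.2].
  - by move=> t' z' i; exact: saturated_chart_pre.
  - by exists 0%N; rewrite /= mulg1 mul1mx.
  exists j => //; rewrite -(wmx_v k j) in e.
  by rewrite (vertex_inj (hisometry_inj (hisometry_wmx R k j) e)).
move=> [j j10 [-> ->]]; apply/esym/cls_eqP; [exact: v_pentagon|exact: v_pentagon|].
have := @dom_glued R H a (true, k) t 0 j (v k) (v (k + j%:R)).
by rewrite /= mul1mx mulg1 wmx_v; apply=> //; exact: v_pentagon.
Qed.

Lemma surface_corners t k :
  #|finset (fun c : H * 'I_5 => cls c.1 (v c.2) == cls t (v k))| = 10%N.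
Proof.
pose F (j : 'I_10) := ((t * tl k j)%g, k + j%:R).
have F_inj : injective F.
  move=> i j [/mulgI e1 e2']; apply: ord_inj.
  have e2 : k + i%:R = k + j%:R by apply: val_inj.
  have d (m : 'I_10) : dom (true, k) (wmx k m *m v (k + m%:R)).
    by rewrite wmx_v /dom /vball /=; have [-> _] := hplane_v R k; lra.
  apply: (@dom_uniq R H a (true, k) i j (v (k + i%:R))) => //; first exact: v_pentagon.
  by rewrite e2; exact: d.
rewrite -[RHS]card_ord -(card_imset _ F_inj); apply: eq_card => -[u l].
rewrite !inE; apply/idP/imsetP => [/eqP/cls_vertexE[j j10 ->]|[j _ ->]].
  by exists (Ordinal j10).
by apply/eqP/cls_vertexE; exists j.
Qed.

End SurfaceGeometry.

(** * Compactness, separation and connectedness *)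

Section SurfaceTopologyGlobal.
Variables (R : realType) (H : finGroupType) (a : gluing H).
Local Notation v := (@hvertex R 5 10).
Local Notation V := 'cV[R]_3.
Local Notation P := (@hpolygon R 5 10).
Local Notation X := (surface R a).
Local Notation half := (half R).
Local Notation wmx := (wmx R).
Local Notation cls := (@cls R H a).
Local Notation tl := (tl a).

Lemma lorentz_vv k l : lorentz (v k) (v l) < 0.
Proof.
have [k1 k0] := hplane_v R k; have [l1 l0] := hplane_v R l.
by rewrite -timelike_future // ?k1 ?l1 ltrN10.
Qed.

(* The coefficients of a point of the pentagon over its vertices are at most 1 *)
(* since all lorentz products of vertices are negative.                        *)
Lemma coef_le1 (b : 'I_5 -> R) : (forall k, 0 <= b k) -> hplane (\sum_k b k *: v k) ->
  forall k, b k <= 1.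
Proof.
move=> b0 [h1 _] k; set z := \sum_k _ in h1.
have zl w : lorentz w z = \sum_l b l * lorentz w (v l).
  have -> : lorentz w z = \sum_l lorentz w (b l *: v l) by exact: linear_sum.
  by apply: eq_bigr => l _; rewrite lorentzZr.
have vz l : lorentz (v l) z <= - b l.
  rewrite zl (bigD1 l) //=; have [-> _] := hplane_v R l; rewrite mulrN1 gerDl.
  by apply: sumr_le0 => m _; rewrite mulr_ge0_le0 // ltW // lorentz_vv.
have : \sum_l b l * b l <= 1.
  rewrite -[1]opprK -h1 zl -sumrN; apply: ler_sum => l _.
  by rewrite -mulrN ler_wpM2l // lerNr lorentzC vz.
move=> h; rewrite -(@ler_pXn2r _ 2) ?nnegrE // expr1n expr2; apply: le_trans h.
by rewrite (bigD1 k) //= lerDl sumr_ge0 // => l _; rewrite mulr_ge0.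
Qed.

(** By [coef_le1] the pentagon is a closed part of the continuous image of a cube. *)
Lemma compact_pentagon : compact P.
Proof.
pose f (u : 'rV[R]_5) : V := \sum_k u 0 k *: v k.
have cf : continuous f.
  apply: continuous_mx => i j.
  have -> : (fun u => f u i j) = fun u => u 0 4 * v 4 i j + u 0 0 * v 0 i j + u 0 1 * v 1 i j
      + u 0 2 * v 2 i j + u 0 3 * v 3 i j.
    by apply/funext => u; rewrite /f sum5 !mxE.
  move=> u; have c k : (fun w : 'rV[R]_5 => w 0 k * v k i j) @ u --> u 0 k * v k i j.
    exact: (cvgM (@coord_continuous R 1 5 0 k u) (cvg_cst _)).
  exact: (cvgD (cvgD (cvgD (cvgD (c 4) (c 0)) (c 1)) (c 2)) (c 3)).
have cA := @rV_compact R 5 (fun=> `[0, 1]%classic) (fun=> @segment_compact R 0 1).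
have cfA := continuous_compact (continuous_subspaceT cf) cA.
apply: subclosed_compact cfA _; first exact: closed_pentagon.
move=> z [hz [b [b0 e]]]; exists (\row_k b k) => [k|]; last first.
  by rewrite /f e; apply: eq_bigr => k _; rewrite mxE.
by rewrite mxE /= in_itv /= b0 coef_le1 // -e.
Qed.

Lemma compact_surface : compact [set: X].
Proof.
have -> : [set: X] = \big[setU/set0]_(t : H) (cls t @` P).
  rewrite -bigcup_seq; apply/seteqP; split=> // x _.
  by have [t [z [Pz ->]]] := cls_surj x; exists t; [exact: mem_index_enum|exists z].
apply: bigsetU_compact => t _; apply: continuous_compact; last exact: compact_pentagon.
exact: cls_continuous.
Qed.

(** Around the chart image of x, choose a neighbourhood whose closure stays in the chart and avoids
    the image of y, if any. The closure has closed trace on each tile, so its complement in the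
    surface is an open neighbourhood of y. *)
Lemma hausdorff_surface : hausdorff_space X.
Proof.
rewrite open_hausdorff => x y xy.
have [t0 [c xc]] := chart_cover x; have [j [z [jc Pz hd ex]]] := xc.
have ce : chart t0 c x = wmx c.2 j *m z by rewrite ex chartE.
pose Q : set V := dom c `&` [set p | chart_dom t0 c y -> p != chart t0 c y].
have nQ : nbhs (chart t0 c x) Q.
  apply: filterI; first by apply: open_nbhs_nbhs; split; [exact: open_dom|rewrite ce].
  have [yc|yc] := pselect (chart_dom t0 c y); last by apply: filterS (filterT) => p _ /yc.
  have cy : closed [set chart t0 c y].
    by apply: accessible_closed_set1; apply: hausdorff_accessible; exact: norm_hausdorff.
  have : nbhs (chart t0 c x) (~` [set chart t0 c y]).
    apply: open_nbhs_nbhs; split; first by rewrite openC.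
    move=> /= e; move/eqP: xy; apply; apply: (chart_inj (t0 := t0) (c := c)) => //; exact: mem_set.
  by apply: filterS => p /= /eqP.
have [B nB BQ] := @uniform_regular V _ _ nQ.
have O1 := @open_chart_dom_pre R H a t0 c _ (open_interior B).
have sF := @saturated_chart_pre R H a t0 c (closure B).
have O2 : open (~` saturation (a := a) (chart_pre a t0 c (closure B))).
  rewrite openC; apply: closed_saturation => // t.
  have -> : chart_pre a t0 c (closure B) t = \bigcup_(j in [set j | (j < sheets c)%N /\
      t = (t0 * tl c.2 j)%g]) ((fun z => wmx c.2 j *m z) @^-1` closure B).
    apply/seteqP; split=> w; first by move=> [i [ic ti _ hw]]; exists i.
    by move=> [i [ic ti] hw]; exists i; split=> //; have [] := BQ _ hw.
  apply: closed_subspaceW; apply: closed_bigcup.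
    by apply: sub_finite_set (finite_II (sheets c)) => i [].
  move=> i _; apply: preimage_closed; last exact: closed_closure.
  by move=> w _; exact: continuous_mulmx.
exists (chart_dom t0 c `&` chart t0 c @^-1` B°,
        ~` saturation (a := a) (chart_pre a t0 c (closure B))) => /=.
  split; apply: mem_set; first by split=> //; exact: nB.
  rewrite -chart_dom_preE => -[yc /= hy]; have [_ /(_ yc)] := BQ _ hy.
  by rewrite eqxx.
split=> //; apply/eqP/seteqP; split=> // w [[wc wB] /=]; apply.
rewrite -chart_dom_preE; split=> //.
by apply: subset_closure; exact: interior_subset wB.
Qed.

Lemma lorentz_v_pentagon k (z : V) : P z -> lorentz (v k) z < 0.
Proof.
move=> /pentagonP[[z1 z0] _]; have [k1 k0] := hplane_v R k.
by rewrite -timelike_future // ?k1 ?z1 ltrN10.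
Qed.

(** The pentagon is star-shaped about [v 0]: straight segments from [v 0] are rescaled back to the
    hyperboloid. *)
Lemma connected_pentagon : connected P.
Proof.
pose u (z : V) (x : R) : V := (1 - x) *: v 0 + x *: z.
pose N z x : R := - lorentz (u z x) (u z x).
pose g z x : V := (Num.sqrt (N z x))^-1 *: u z x.
have NE z x : P z -> N z x = (1 - x) ^+ 2 + x ^+ 2 + 2 * (x * (1 - x) * - lorentz (v 0) z).
  move=> /pentagonP[[z1 _] _]; have [v1 _] := hplane_v R 0.
  rewrite /N /u !(lorentzDl, lorentzDr, lorentzZl, lorentzZr) z1 v1 (lorentzC z).
  by ring.
have N0 z x : P z -> 0 <= x <= 1 -> 0 < N z x.
  move=> Pz /andP[x0 x1]; rewrite NE //; have := lorentz_v_pentagon 0 Pz => h.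
  have h1 : 0 <= x * (1 - x) * - lorentz (v 0) z.
    by rewrite mulr_ge0 ?mulr_ge0 //; lra.
  have h2 : 0 < (1 - x) ^+ 2 + x ^+ 2.
    have -> : (1 - x) ^+ 2 + x ^+ 2 = 1 / 2 + 2 * (x - 1 / 2) ^+ 2 by field.
    by have := sqr_ge0 (x - 1 / 2); lra.
  lra.
have gP z x : P z -> 0 <= x <= 1 -> P (g z x).
  move=> Pz x01; have N1 := N0 z x Pz x01; have /andP[x0 x1] := x01.
  have s0 : 0 < (Num.sqrt (N z x))^-1 by rewrite invr_gt0 sqrtr_gt0.
  have /pentagonP[[_ z2] hz] := Pz.
  apply/pentagonP; split; last first.
    move=> k; rewrite /g /u linearZ linearD !linearZ /= mulr_ge0 ?(ltW s0) //.
    by rewrite addr_ge0 // mulr_ge0 ?nf_v_ge0 //; lra.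
  split.
    rewrite /g lorentzZl lorentzZr mulrA -expr2 exprVn sqr_sqrtr ?ltW //.
    by rewrite -[lorentz _ _]opprK -/(N z x) mulrN mulVf // gt_eqF.
  have -> : g z x 2 0 = (Num.sqrt (N z x))^-1 * ((1 - x) * v 0 2 0 + x * z 2 0).
    by rewrite /g /u; move: (v 0) => w; rewrite !mxE.
  rewrite mulr_gt0 //; have [_ v0] := hplane_v R 0.
  have [->|xn] := eqVneq x 0; first by rewrite mul0r addr0 subr0 mul1r.
  have x2 : 0 < x by rewrite lt_neqAle eq_sym xn.
  by rewrite ltr_wpDl ?mulr_gt0 // mulr_ge0 ?(ltW v0) //; lra.
have cg z : P z -> {within `[0, 1], continuous (g z)}.
  move=> Pz; apply: continuous_in_subspaceT => x /set_mem /=; rewrite in_itv /= => x01.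
  have cN : continuous (N z).
    have -> : N z = fun x => (1 - x) ^+ 2 + x ^+ 2 + 2 * (x * (1 - x) * - lorentz (v 0) z).
      by apply/funext => y; exact: NE.
    move=> y; have c1 : (fun y : R => 1 - y) @ y --> 1 - y.
      by apply: cvgB; [exact: cvg_cst|exact: cvg_id].
    have c2 : (fun y : R => y) @ y --> y by exact: cvg_id.
    apply: (cvgD (cvgD (cvgM c1 c1) (cvgM c2 c2))).
    exact: (cvgM (cvg_cst _) (cvgM (cvgM c2 c1) (cvg_cst _))).
  have cs : (fun y => (Num.sqrt (N z y))^-1) @ x --> (Num.sqrt (N z x))^-1.
    apply: cvgV; first by rewrite gt_eqF // sqrtr_gt0 N0.
    exact: (continuous_comp (cN x) (@sqrt_continuous R (N z x))).
  apply: continuous_at_mx => i j.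
  have cu : (fun y => u z y i j) @ x --> u z x i j.
    have uE y : u z y i j = (1 - y) * v 0 i j + y * z i j.
      by rewrite /u; move: (v 0) => w; rewrite !mxE.
    rewrite uE (_ : (fun y => u z y i j) = fun y => (1 - y) * v 0 i j + y * z i j).
      have c1 : (fun y : R => 1 - y) @ x --> 1 - x by apply: cvgB; [exact: cvg_cst|exact: cvg_id].
      exact: (cvgD (cvgM c1 (cvg_cst _)) (cvgM cvg_id (cvg_cst _))).
    by apply/funext => y; exact: uE.
  have gE y : g z y i j = (Num.sqrt (N z y))^-1 * u z y i j.
    by rewrite /g; move: (u z y) => w; rewrite !mxE.
  rewrite /prop_for /continuous_at gE (_ : (fun y => g z y i j) =
    (fun y => (Num.sqrt (N z y))^-1) \* (fun y => u z y i j)); first exact: cvgM cs cu.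
  by apply/funext => y; exact: gE.
have -> : P = \bigcup_(z in P) (g z @` `[0, 1]).
  apply/seteqP; split=> [z Pz|_ [z Pz [x x01 <-]]]; last first.
    by apply: gP => //; move: x01; rewrite /= in_itv.
  exists z => //; exists 1; first by rewrite /= in_itv /= ler01 lexx.
  rewrite /g /N /u subrr scale0r add0r scale1r; have /pentagonP[[-> _] _] := Pz.
  by rewrite opprK sqrtr1 invr1 scale1r.
apply: bigcup_connected.
  exists (v 0) => z Pz; exists 0; first by rewrite /= in_itv /= ler01 lexx.
  rewrite /g /N /u subr0 scale0r addr0 scale1r; have [-> _] := hplane_v R 0.
  by rewrite opprK sqrtr1 invr1 scale1r.
move=> z Pz; apply: connected_continuous_connected; last exact: cg.
exact: segment_connected.
Qed.

(** Neighbouring tiles share a point, so right translation by a gluing element preserves the set of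
    tiles in a component. The translations preserving it form a group, and [glue_gen] makes it
    everything. *)
Lemma connected_surface : connected [set: X].
Proof.
pose x0 := cls 1%g (v 0); pose C := connected_component [set: X] x0.
have CE t z : P z -> C (cls t z) -> forall w, P w -> C (cls t w).
  move=> Pz Cz w Pw; apply: connected_component_trans Cz _.
  have Iz : (cls t @` P) (cls t z) by exists z.
  have cI : connected (cls t @` P).
    by apply: connected_continuous_connected; [exact: connected_pentagon|exact: cls_continuous].
  by apply: (connected_component_max Iz (@subsetT _ _) cI); exists w.
pose T := [set t : H | `[< C (cls t (v 0)) >]]%SET.
pose G := [set g : H | [forall t, (t \in T) == ((t * g)%g \in T)]]%SET.
have gG : group_set G.
  apply/group_setP; split; first by rewrite inE; apply/forallP => t; rewrite mulg1.
  move=> g h; rewrite !inE => /forallP hg /forallP hh; apply/forallP => t.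
  by rewrite (eqP (hg t)) (eqP (hh _)) mulgA.
have aG l : a l \in Group gG.
  have h t : C (cls t (v 0)) -> C (cls (t * a l)%g (v 0)).
    move=> Ct; have [||Pm m0] := @half_side R l (v l); first exact: v_pentagon.
      by apply: (proj2 (iffLR (@sideP R l (v l)) _)); split; [exact: hplane_v|
        exists 1, 0; split=> //; rewrite scale1r scale0r addr0].
    apply: (CE _ _ Pm); last exact: v_pentagon.
    rewrite -cls_half; [|exact: v_pentagon|].
      by apply: CE Ct _ _; exact: v_pentagon.
    by have [_ ] := half_side Pm m0; rewrite halfKv.
  rewrite inE; apply/forallP => t; apply/eqP; rewrite !inE; apply/asboolP/asboolP; first exact: h.
  by move=> /h; rewrite -mulgA glue_inv mulg1.
have CT : C = setT.
  apply/seteqP; split=> // x _; have [t [z [Pz ->]]] := cls_surj x.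
  have := glue_gen aG t; rewrite inE => /forallP/(_ 1%g); rewrite mul1g !inE => /eqP e.
  have Ct : C (cls t (v 0)).
    by apply/asboolP; rewrite -e; apply/asboolP; exact: connected_component_refl.
  by apply: CE Ct _ Pz; exact: v_pentagon.
by rewrite -CT; exact: component_connected.
Qed.

End SurfaceTopologyGlobal.

(** * The tiled surface and its genus *)

Section TiledSurfaces.
Variables (R : realType).
Local Notation v := (@hvertex R 5 10).
Local Notation V := 'cV[R]_3.
Local Notation P := (@hpolygon R 5 10).
Local Notation half := (half R).
Local Notation wmx := (wmx R).

Definition surface_atlas (H : finGroupType) (a : gluing H) :
    set (set (surface R a) * (surface R a -> V)) :=
  [set ch | exists t0 c, ch = (chart_dom t0 c, chart t0 c)].

Arguments surface_atlas {H} a.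

Lemma hyperbolic_surface_atlas (H : finGroupType) (a : gluing H) :
  is_hyperbolic_atlas (surface_atlas a).
Proof.
split.
- by move=> _ [t0 [c ->]]; exact: surface_chart.
- move=> x; have [t0 [c h]] := chart_cover x.
  by exists (chart_dom t0 c, chart t0 c) => //; exists t0, c.
- by move=> _ _ x [t0 [c ->]] [t1 [d ->]]; exact: surface_transition.
Qed.

Lemma surface_tile_isometry_atlas (H : finGroupType) (a : gluing H) t (z : V) ch :
  P z -> surface_atlas a ch -> ch.1 (@cls R H a t z) -> exists2 A, hisometry A &
    \forall w \near z, P w -> ch.2 (@cls R H a t w) = A *m w.
Proof. by move=> Pz [t0 [c ->]]; exact: surface_tile_isometry. Qed.

Lemma surface_covered (H : finGroupType) (a : gluing H) (x : surface R a) :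
  exists t, (@cls R H a t @` P) x.
Proof. by have [t [z [Pz ->]]] := cls_surj x; exists t, z. Qed.

Definition glued_surface (H : finGroupType) (a : gluing H) : tiled_surface R 5 10 H :=
  TiledSurface (@compact_surface R H a) (@hausdorff_surface R H a)
    (@connected_surface R H a) (hyperbolic_surface_atlas a)
    (@cls_continuous R H a) (@surface_tile_isometry_atlas H a)
    (@surface_covered H a) (@surface_interior R H a) (@surface_side_inj R H a)
    (@surface_side_meet R H a) (@surface_corners R H a).

Lemma card_fibers (D : finType) (Y : choiceType) (F : D -> Y) (N : nat) :
  (forall c, #|[pred d | F d == F c]| = N) ->
  (#|` fset_set [set F c | c in [set: D]]|%fset * N)%N = #|D|.
Proof.
move=> hF; pose s := [seq F d | d <- enum D].
have fA : finite_set [set F c | c in [set: D]] by apply: finite_image; exact: finite_finset.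
have -> : #|` fset_set [set F c | c in [set: D]]|%fset = size (undup s).
  apply: perm_size; apply: uniq_perm; [exact: fset_uniq|exact: undup_uniq|].
  move=> y; rewrite mem_undup; apply/idP/mapP => [|[d _ ->]].
    by rewrite in_fset_set // => /set_mem[d _ <-]; exists d => //; rewrite mem_enum.
  by rewrite in_fset_set //; apply: mem_set; exists d.
have iN m : iterop m addn 1%N 0%N = m.
  by rewrite Monoid.iteropE; elim: m => [//|m IH] /=; rewrite IH.
rewrite cardE -(size_map F) -/s; transitivity (\sum_(y <- undup s) N)%N.
  by rewrite -sum1_size big_distrl /=; under eq_bigr do rewrite mul1n.
rewrite -sum1_size -[RHS](big_undup_iterop_count _ s xpredT (fun=> 1%N)) /=.
apply: eq_big_seq => y; rewrite mem_undup => /mapP[c _ ->].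
rewrite iN count_map -(hF c) cardE -size_filter /enum_mem -filter_predI; congr size.
by apply: eq_filter => d; rewrite !inE andbT.
Qed.

(** The witness is the midpoint: the sum of the two ends, rescaled to the hyperboloid. *)
Lemma side_open_ex k : exists z : V, @hside_open R 5 10 k z.
Proof.
pose L := lorentz (v k) (v (k + 1)).
have L0 : 0 < 2 - 2 * L by have := lorentz_vv R k (k + 1); rewrite -/L; lra.
pose s := (Num.sqrt (2 - 2 * L))^-1.
have s0 : 0 < s by rewrite invr_gt0 sqrtr_gt0.
exists (s *: v k + s *: v (k + 1)); split; last by exists s, s; rewrite ordS5E.
have [k1 k0] := hplane_v R k; have [l1 l0] := hplane_v R (k + 1).
split.
  rewrite !(lorentzDl, lorentzDr, lorentzZl, lorentzZr) k1 l1 (lorentzC (v (k + 1))) -/L.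
  transitivity (- (s ^+ 2 * (2 - 2 * L))); first by ring.
  by rewrite /s exprVn sqr_sqrtr ?ltW // mulVf // gt_eqF.
move: k0 l0; move: (v k) (v (k + 1)) => x y x0 y0.
by rewrite !mxE addr_gt0 // mulr_gt0.
Qed.

Section Combinatorics.
Variables (H : finGroupType) (a : gluing H).
Local Notation S := (glued_surface a).

Lemma tile_side_eqP t k u l : tile_side S t k = tile_side S u l <->
  (u, l) = (t, k) \/ (u, l) = ((t * a k)%g, k).
Proof.
split=> [e|[[-> ->]|[-> ->]]] //; last exact: side_image_step.
have [z hz] := side_open_ex k; have /side_openP[hz1 z0 _ _] := hz.
have Pz := side_openW hz.
have : tile_side S t k (@cls R H a t z) by exists z => //; apply/sideP.
rewrite e => -[w /sideP[Pw w0] /esym/cls_eqP -/(_ Pz Pw) g].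
have lk x : @hside_open R 5 10 k x -> nf l x = 0 -> l = k.
  move=> hx x0; apply/eqP/negPn/negP => lk.
  by have := side_open_pos hx lk; rewrite x0 ltxx.
case: (glued_side hz g) => -[-> ew]; rewrite ew in w0.
  by left; rewrite (lk z).
by right; rewrite (lk _ (half_side_open hz)).
Qed.

Lemma card_vertices : (#|` fset_set (@vertices R 5 10 H S)|%fset * 10)%N = (#|H| * 5)%N.
Proof.
rewrite -[in RHS](card_ord 5) -card_prod.
apply: (@card_fibers _ _ (fun c => tile_vertex S c.1 c.2)) => c.
by rewrite -[RHS](@surface_corners R H a c.1 c.2) cardsE.
Qed.

Lemma card_edges : (#|` fset_set (@edges R 5 10 H S)|%fset * 2)%N = (#|H| * 5)%N.
Proof.
rewrite -[in RHS](card_ord 5) -card_prod.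
apply: (@card_fibers _ _ (fun c => tile_side S c.1 c.2)) => -[t k] /=.
have ne : (t, k) != ((t * a k)%g, k).
  by rewrite xpair_eqE eqxx andbT -{1}[t]mulg1 (inj_eq (mulgI t)) eq_sym glue_neq1.
transitivity #|[set (t, k); ((t * a k)%g, k)]%SET|; last by rewrite cards2 ne.
apply: eq_card => -[u l]; rewrite !inE /=.
apply/eqP/orP => [/esym/tile_side_eqP|h]; first by case=> ->; [left|right].
by apply/esym/tile_side_eqP; case: h => /eqP; [left|right].
Qed.

(** The Euler characteristic is 12 n - 60 n + 24 n = - 24 n. *)
Lemma glued_surface_genus n : #|H| = (24 * n)%N -> has_genus S (12 * n + 1).
Proof.
move=> cH; have hv := card_vertices; have he := card_edges; rewrite cH in hv he.
rewrite /has_genus /euler_characteristic cH.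
have -> : #|` fset_set (@vertices R 5 10 H S)|%fset = (12 * n)%N by lia.
have -> : #|` fset_set (@edges R 5 10 H S)|%fset = (60 * n)%N by lia.
lia.
Qed.

Lemma glued_surface_assembled t k :
  [/\ tile_side S t k = tile_side S (t * a k)%g k,
      tile_vertex S t k = tile_vertex S (t * a k)%g (ordS k) &
      tile_vertex S t (ordS k) = tile_vertex S (t * a k)%g k].
Proof.
have vk : nf k (v k) = 0 by rewrite -{1}[k]addr0 nf_v.
have vk1 : nf k (v (k + 1)) = 0.
  have := nf_v R (k + 1) 4; rewrite addrAC addr4_1 => ->.
  by [].
split.
- exact: side_image_step.
- by rewrite ordS5E /tile_vertex /= (cls_half a t (v_pentagon R k) vk) half_v.
- by rewrite ordS5E /tile_vertex /= (cls_half a t (v_pentagon R (k + 1)) vk1) half_vS.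
Qed.

Lemma glued_surface_common_side t u : t != u ->
  have_common_side S t u <-> exists k, u = (t * a k)%g.
Proof.
move=> tu; split=> [[k [l /tile_side_eqP[[e _]|[-> _]]]]|[k ->]].
- by rewrite e eqxx in tu.
- by exists k.
- by exists k, k; apply/tile_side_eqP; right.
Qed.

End Combinatorics.

(** * The covering induced by a surjection of groups *)

Section Covering.
Variables (H K : finGroupType) (a : gluing H) (b : gluing K).
Variable d : {morphism [set: H]%SET >-> K}.
Hypothesis d_glue : forall k, d (a k) = b k.
Hypothesis d_onto : (d @* [set: H]%SET)%g = [set: K]%SET.
Local Notation X := (glued_surface a).
Local Notation Y := (glued_surface b).

Lemma d_mul t u : d (t * u)%g = (d t * d u)%g.
Proof. by rewrite morphM ?inE. Qed.

Lemma d_tl k j : d (tl a k j) = tl b k j.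
Proof. by elim: j => [|j IH] /=; rewrite ?morph1 // d_mul IH d_glue. Qed.

Lemma glued_map t u (z w : V) : glued a (t, z) (u, w) -> glued b (d t, z) (d u, w).
Proof.
move=> g S cS Sz; apply: (g [set x | S (d x.1, x.2)]) => // t' z' l Pz z0 /= h.
by rewrite d_mul d_glue; exact: cS.
Qed.

Lemma cls_rep (x : surface R a) : exists u, P u.2 /\ x = @cls R H a u.1 u.2.
Proof. by have [t [z [Pz ->]]] := cls_surj x; exists (t, z). Qed.

Definition covering_map (x : X) : Y :=
  let u := sval (cid (cls_rep x)) in @cls R K b (d u.1) u.2.

Lemma covering_mapE t (z : V) : P z ->
  covering_map (@cls R H a t z) = @cls R K b (d t) z.
Proof.
move=> Pz; rewrite /covering_map; have [] := svalP (cid (cls_rep (@cls R H a t z))).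
move: (sval _) => -[u w] /= Pw /cls_eqP -/(_ Pz Pw) g.
by apply/esym/cls_eqP => //; exact: glued_map.
Qed.

Lemma continuous_covering_map : continuous covering_map.
Proof.
apply/continuousP => W /open_surfaceP oW; apply/open_surfaceP => t.
have /open_subspaceP[Q oQ e] := oW (d t); apply/open_subspaceP; exists Q => //.
rewrite e; apply/seteqP; split=> z [/= h Pz]; split=> //=.
  by rewrite covering_mapE.
by move: h; rewrite covering_mapE.
Qed.

Lemma covering_map_dom t0 c (x : X) : chart_dom t0 c x ->
  chart_dom (d t0) c (covering_map x) /\ chart (d t0) c (covering_map x) = chart t0 c x.
Proof.
move=> [j [z [jc Pz hd ->]]]; rewrite covering_mapE // d_mul d_tl !chartE //.
by split=> //; exists j, z.
Qed.

Lemma covering_map_preimage u0 c (x : X) : chart_dom u0 c (covering_map x) ->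
  exists2 t0, d t0 = u0 & chart_dom t0 c x.
Proof.
have [t [z [Pz ->]]] := cls_surj x; rewrite covering_mapE //.
move=> /(chart_dom_clsE _ _ _ _ Pz)[j [jc dt hd]].
exists (t * (tl a c.2 j)^-1)%g; last first.
  by apply/(chart_dom_clsE _ _ _ _ Pz); exists j; split=> //; rewrite mulgKV.
by rewrite d_mul dt morphV ?inE // d_tl mulgK.
Qed.

(** The point has the same sheet number in both charts, by [dom_uniq] for [b]; the base tiles then
    agree by cancellation. *)
Lemma chart_dom_disjoint t0 t1 c (x : X) : d t0 = d t1 ->
  chart_dom t0 c x -> chart_dom t1 c x -> t0 = t1.
Proof.
move=> dt [j [z [jc Pz hj ->]]] /(chart_dom_clsE _ _ _ _ Pz)[i [ic e hi]].
have /mulgI : (d t0 * tl b c.2 j)%g = (d t0 * tl b c.2 i)%g by rewrite {2}dt -!d_tl -!d_mul e.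
move=> /(dom_uniq (a := b) jc ic Pz hj hi) ij.
by move: e; rewrite ij => /mulIg.
Qed.

Lemma covering_map_sheet t0 c : covering_map @` chart_dom t0 c = chart_dom (d t0) c.
Proof.
apply/seteqP; split=> [_ [x hx <-]|_ [j [z [jc Pz hd ->]]]].
  by have [] := covering_map_dom hx.
exists (@cls R H a (t0 * tl a c.2 j)%g z); first by exists j, z.
by rewrite covering_mapE // d_mul d_tl.
Qed.

Lemma covering_map_open t0 c (W : set X) : open W -> W `<=` chart_dom t0 c ->
  open (covering_map @` W).
Proof.
move=> oW WU; have [_ _ _ _ /(_ W oW WU)[Q oQ e]] := @surface_chart R H a t0 c.
suff -> : covering_map @` W = chart_dom (d t0) c `&` chart (d t0) c @^-1` Q.
  exact: open_chart_dom_pre.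
apply/seteqP; split=> [_ [x Wx <-]|y [yc yQ]].
  have [h1 h2] := covering_map_dom (WU _ Wx); split=> //; rewrite /= h2.
  have : (chart t0 c @` W) (chart t0 c x) by exists x.
  by rewrite e => -[].
have hy : hplane (chart (d t0) c y).
  have [_ _ _ h _] := @surface_chart R K b (d t0) c.
  by apply: h; exists y.
have : (Q `&` @hplane R) (chart (d t0) c y) by [].
rewrite -e => -[x Wx ex]; exists x => //.
have [h1 h2] := covering_map_dom (WU _ Wx).
by apply: (chart_inj (t0 := d t0) (c := c)); rewrite ?h2 //; exact: mem_set.
Qed.

(** Over the chart at [u0], the sheets are the charts of the same shape at the tiles of the coset
    [t1 * 'ker d] mapping to [u0]. *)
Lemma glued_surface_covering n : #|('ker d)%g| = n -> is_covering n covering_map.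
Proof.
move=> <-; split=> [|y]; first exact: continuous_covering_map.
have [u0 [c hc]] := chart_cover y.
have /morphimP[t1 _ _ dt1] : u0 \in (d @* [set: H]%SET)%g by rewrite d_onto inE.
have dk (i : 'I_#|('ker d)%g|) : d (t1 * enum_val i)%g = u0.
  by rewrite d_mul (mker (enum_valP i)) mulg1.
exists (chart_dom u0 c), (fun i => chart_dom (t1 * enum_val i)%g c); split.
- by split=> //; exact: open_chart_dom.
- apply/seteqP; split=> [x /covering_map_preimage[t0 dt0 hx]|x [i _ hx]].
    have kt : (t1^-1 * t0)%g \in ('ker d)%g.
      by apply/kerP; rewrite ?inE // d_mul morphV ?inE // dt0 dt1 mulVg.
    exists (enum_rank_in kt (t1^-1 * t0)%g) => //.
    by rewrite enum_rankK_in // mulKVg.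
  by rewrite /preimage /= -(dk i); have [] := covering_map_dom hx.
- move=> i j ij; apply/seteqP; split=> // x [hi hj].
  have /mulgI/enum_val_inj e := chart_dom_disjoint (etrans (dk i) (esym (dk j))) hi hj.
  by rewrite e eqxx in ij.
move=> i; split.
- exact: open_chart_dom.
- move=> x y' /set_mem hx /set_mem hy e.
  have [_ ex] := covering_map_dom hx; have [_ ey] := covering_map_dom hy.
  by apply: (chart_inj (mem_set hx) (mem_set hy)); rewrite -ex -ey e.
- by rewrite covering_map_sheet dk.
- by move=> W oW WU; exact: covering_map_open WU.
Qed.

End Covering.

End TiledSurfaces.

(** * Contextual inversions *)

Section ContextualInversions.
Local Open Scope ring_scope.
Implicit Types (y T : segment).

Lemma p_E i j y : p_ i j y = contextual i j y.
Proof. by rewrite permE. Qed.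

Lemma p_G5 i : p_ i (ordS i) \in G5.
Proof. by apply: mem_gen; apply/imsetP; exists i. Qed.

Lemma p_K i : (p_ i (ordS i) * p_ i (ordS i))%g = 1%g.
Proof. by apply/permP => y; rewrite permM perm1 !p_E contextualK. Qed.

Definition corner_turn (k : 'I_5) : {perm segment} :=
  (p_ k (ordS k) * p_ (k + 1)%R (ordS (k + 1)) * p_ (k + 2)%R (ordS (k + 2))
   * p_ (k + 3)%R (ordS (k + 3)) * p_ (k + 4)%R (ordS (k + 4)))%g.

(* Going around the k-th vertex five times inverts the segment at its k-th pitch. *)
Lemma corner_turnE k y : corner_turn k y = inversion (y 0 k + y 0 k) y.
Proof.
rewrite /corner_turn !ordS5E addr4_1.
have -> : k + 1 + 1 = k + 2 by rewrite -addrA; congr (_ + _); apply: val_inj.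
have -> : k + 2 + 1 = k + 3 by rewrite -addrA; congr (_ + _); apply: val_inj.
have -> : k + 3 + 1 = k + 4 by rewrite -addrA; congr (_ + _); apply: val_inj.
by rewrite !permM !p_E; apply/rowP => i; rewrite !mxE; ring.
Qed.

Lemma corner_turnK k : (corner_turn k ^+ 2)%g = 1%g.
Proof.
apply/permP => y; rewrite expgS expg1 permM perm1 !corner_turnE.
by apply/rowP => i; rewrite !mxE; ring.
Qed.

Lemma corner_turn_G5 k : corner_turn k \in G5.
Proof. by rewrite /corner_turn !groupM ?p_G5. Qed.

Lemma TI_orbitP T y : reflect (exists m, y = transposition m T \/ y = inversion m T)
  (y \in TI_orbit T).
Proof.
apply: (iffP setUP) => [[/imsetP[m _ ->]|/imsetP[m _ ->]]|[m [->|->]]].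
- by exists m; left.
- by exists m; right.
- by left; apply/imsetP; exists m.
- by right; apply/imsetP; exists m.
Qed.

Lemma contextual_TI i j T y : y \in TI_orbit T -> contextual i j y \in TI_orbit T.
Proof.
move=> /TI_orbitP[m [->|->]]; apply/TI_orbitP.
  exists (T 0 i + T 0 j + m); right.
  by apply/rowP => k; rewrite !mxE; ring.
exists (m - T 0 i - T 0 j); left.
by apply/rowP => k; rewrite !mxE; ring.
Qed.

Lemma G5_TI T : G5 \subset 'N(TI_orbit T | 'P)%g.
Proof.
rewrite gen_subG; apply/fintype.subsetP => g /imsetP[i _ ->]; apply/astabsP => y.
rewrite /= /aperm p_E; apply/idP/idP; last exact: contextual_TI.
by move=> /(contextual_TI i (ordS i)); rewrite contextualK.
Qed.

Lemma TI_self T : T \in TI_orbit T.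
Proof.
by apply/TI_orbitP; exists 0; left; apply/rowP => k; rewrite mxE addr0.
Qed.

(** If an inversion fixed T, all doubled pitches would equal m, so doubled differences would vanish
    and the congruence would give 2 = 0 modulo 12. *)
Lemma inversion_neq T m : (exists l2 l3 l4 l5 : int,
    (T 0 1 - T 0 0) *~ l2 + (T 0 2 - T 0 0) *~ l3
    + (T 0 3 - T 0 0) *~ l4 + (T 0 4 - T 0 0) *~ l5 = 1) ->
  inversion m T <> T.
Proof.
move=> [l2 [l3 [l4 [l5 e]]]] /rowP h.
have dbl k : T 0 k *+ 2 = m.
  by have := h k; rewrite !mxE => ek; rewrite mulr2n -{1}ek; ring.
have d k : (T 0 k - T 0 0) *+ 2 = 0 by rewrite mulrnBl !dbl subrr.
have d' k l : ((T 0 k - T 0 0) *~ l) *+ 2 = 0.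
  by rewrite pmulrn -mulrzA mulrC mulrzA -pmulrn d mul0rz.
have : (1 : 'Z_12) *+ 2 = 0 by rewrite -e !mulrnDl !d' !addr0.
by [].
Qed.

(* f stands for the quotient map of G5 and for its composite with the action on *)
(* the orbit of T.                                                              *)
Lemma ex_gluing (H : finGroupType) (f : {perm segment} -> H) (T : segment) :
  {in G5 &, {morph f : x y / (x * y)%g >-> (x * y)%g}} ->
  (forall t, exists2 g, g \in G5 & t = f g) ->
  (forall g m, g \in G5 -> g T = inversion m T -> f g <> 1%g) ->
  exists a : gluing H, forall i, a i = f (p_ i (ordS i)).
Proof.
move=> fM f_onto f_neq.
have f1 : f 1%g = 1%g.
  by apply: (mulgI (f 1%g)); rewrite -fM ?group1 // !mulg1.
have a1 i : (f (p_ i (ordS i)) * f (p_ i (ordS i)))%g = 1%g.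
  by rewrite -fM ?p_G5 // p_K.
have a2 i : f (p_ i (ordS i)) != 1%g.
  by apply/eqP; apply: f_neq; [exact: p_G5|rewrite p_E].
have fc k : f (corner_turn k) = (f (p_ k (ordS k)) * f (p_ (k + 1)%R (ordS (k + 1)%R))
    * f (p_ (k + 2)%R (ordS (k + 2)%R)) * f (p_ (k + 3)%R (ordS (k + 3)%R))
    * f (p_ (k + 4)%R (ordS (k + 4)%R)))%g.
  by rewrite /corner_turn !fM ?groupM ?p_G5.
have a4 k : f (corner_turn k) != 1%g.
  by apply/eqP; apply: f_neq; [exact: corner_turn_G5|exact: corner_turnE].
have a5 k : (f (corner_turn k) ^+ 2)%g = 1%g.
  by rewrite expgS expg1 -fM ?corner_turn_G5 // -{2}(expg1 (corner_turn k)) -expgS corner_turnK.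
(* The preimage of [G] in [G5] is a subgroup containing all generators. *)
have a6 (G : {group H}) : (forall i, f (p_ i (ordS i)) \in G) -> forall t, t \in G.
  move=> hG t; have [g gG5 ->] := f_onto t.
  pose B := [set x in G5 | f x \in G]%SET.
  have gB : group_set B.
    apply/group_setP; split; first by rewrite inE group1 f1 group1.
    move=> x y; rewrite !inE => /andP[x5 xG] /andP[y5 yG].
    by rewrite groupM // fM // groupM.
  have : G5 \subset Group gB.
    rewrite gen_subG; apply/fintype.subsetP => x /imsetP[i _ ->].
    by rewrite inE p_G5 hG.
  by move=> /fintype.subsetP/(_ g gG5); rewrite inE => /andP[].
by exists (@Gluing H (fun i => f (p_ i (ordS i))) a1 a2
  (fun k => etrans (f_equal (fun x => x != 1%g) (esym (fc k))) (a4 k))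
  (fun k => etrans (f_equal (fun x => x ^+ 2)%g (esym (fc k))) (a5 k)) a6).
Qed.

End ContextualInversions.

Theorem theorem1 (R : realType) (T : segment)
    (hT : exists l2 l3 l4 l5 : int,
      (T 0 1 - T 0 0) *~ l2 + (T 0 2 - T 0 0) *~ l3
      + (T 0 3 - T 0 0) *~ l4 + (T 0 4 - T 0 0) *~ l5 = 1)
    (GT : finGroupType) (quo : {morphism G5 >-> GT})
    (hquo : is_restriction T quo)
    (delta : {morphism [set: GT] >-> D12})
    (theta : {morphism [set: D12] >-> {perm segment}})
    (hdelta : is_induced_action T quo delta theta)
    (aT : finGroupType) (Ab : {group aT}) (iota : {morphism Ab >-> GT})
    (hexact : short_exact iota delta)
    (hab : abelian Ab) (n : nat) (hn : #|Ab| = n) :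
  exists (V : tiled_surface R 5 10 GT)
         (J : finType) (Gam : tiled_surface R 5 10 J) (f : V -> Gam),
    [/\ is_assembled quo V,
        forall g h : GT, g != h ->
          (have_common_side V g h <->
           exists i, h = invert quo i g \/ g = invert quo i h),
        is_covering n f /\ (has_genus Gam 13 /\ #|J| = 24%N),
        #|GT| = (24 * n)%N &
        has_genus V (12 * n + 1)%N].
Proof.
have [quo_onto _] := hquo; have [_ hact] := hdelta; have [inj_iota im_iota delta_onto] := hexact.
(* An element with trivial image in [D12] acts trivially on the orbit, so it fixes T. *)
have delta_neq g m : g \in G5 -> g T = inversion m T -> delta (quo g) <> 1%g.
  move=> g5 gT d1; apply: (inversion_neq (m := m) hT); rewrite -gT.
  have := hact g g5; rewrite d1 morph1 => /permP/(_ T).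
  rewrite perm1 restr_permE ?TI_self //.
  exact: (fintype.subsetP (G5_TI T)).
have quo_ex t : exists2 g, g \in G5 & t = quo g.
  have : t \in (quo @* G5)%g by rewrite quo_onto inE.
  by case/morphimP=> g g5 _ ->; exists g.
have [a aE] : exists a : gluing GT, forall i, a i = quo (p_ i (ordS i)).
  apply: (@ex_gluing _ _ T) => //; first exact: morphM.
  by move=> g m g5 gT q1; apply: (delta_neq g m g5 gT); rewrite q1 morph1.
have [b bE] : exists b : gluing D12, forall i, b i = delta (quo (p_ i (ordS i))).
  apply: (@ex_gluing _ (fun g => delta (quo g)) T) => //.
    by move=> x y x5 y5; rewrite !morphM ?inE.
  move=> t; have : t \in (delta @* [set: GT]%SET)%g by rewrite delta_onto inE.
  by case/morphimP=> u _ _ ->; have [g g5 ->] := quo_ex u; exists g.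
have d_glue k : delta (a k) = b k by rewrite aE bE.
have cker : #|('ker delta)%g| = n by rewrite -im_iota card_injm.
have cD12 : #|D12| = 24%N by rewrite -cardsT (@card_dihedral 12).
have cGT : #|GT| = (24 * n)%N.
  have := card_morphim delta [set: GT]%G; rewrite delta_onto cardsT cD12 finset.setIid => ->.
  by rewrite -cker mulnC -cardsT Lagrange ?finset.subsetT.
exists (glued_surface R a), D12, (glued_surface R b), (@covering_map R _ _ a b delta).
split=> //.
- by move=> g i; rewrite /invert -aE; exact: glued_surface_assembled.
- move=> g h gh; rewrite glued_surface_common_side //; split=> -[k e]; exists k.
    by left; rewrite /invert -aE.
  case: e => ->; rewrite /invert -aE // -mulgA glue_inv mulg1.
  by [].
- split; first exact: glued_surface_covering.
  (* The base has |D12| = 24 * 1 tiles, whence genus 12 * 1 + 1. *)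
  by split=> //; exact: (@glued_surface_genus R _ b 1).
- exact: glued_surface_genus.
Qed.
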